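(* Let $\mu$ be a Borel probability measure on $\mathbb{R}$ and let $\epsilon>0$. Then $$\lim_{n\to\infty} n\, d_{\epsilon}(\mu,\delta_{\bullet}^{\bullet,n}) = \int_{\mathbb{R}} \Omega\!\left(\epsilon\,\frac{\mathrm{d}(\mu^{-1})_{\sf A}}{\mathrm{d}\lambda}\right)\mathrm{d}\lambda .$$
   Context: $\mathbb{R}^+$ denotes the positive reals, and $\lambda$ is Lebesgue measure on $\mathbb{R}$. For a Borel probability measure $\mu$ on $\mathbb{R}$ let $F_\mu(x)=\mu((-\infty,x])$ and $F_{\mu-}(x)=\mu((-\infty,x))$. For $\epsilon>0$ the $\epsilon$-Lévy metric is $$d_\epsilon(\mu,\nu)=\inf\{y\in\mathbb{R}^+ : F_{\mu-}(x-y/\epsilon)-y\le F_\nu(x)\le F_\mu(x+y/\epsilon)+y \text{ for all } x\in\mathbb{R}\}.$$ Best approximation: for $n\in\mathbb{N}=\{1,2,\ldots\}$ let $\Xi_n=\{x\in\mathbb{R}^n: x_{,1}\le\ldots\le x_{,n}\}$, $\Pi_n=\{p\in\mathbb{R}^n:p_{,j}\ge0,\ \sum_{j=1}^np_{,j}=1\}$, and $\delta_x^p=\sum_{j=1}^np_{,j}\delta_{x_{,j}}$ for $x\in\Xi_n$, $p\in\Pi_n$, where $\delta_a$ is the unit point mass at $a$. The symbol $\delta_\bullet^{\bullet,n}$ denotes any best $d_\epsilon$-approximation of $\mu$, that is, any $\delta_x^p$ with $x\in\Xi_n$, $p\in\Pi_n$ such that $d_\epsilon(\mu,\delta_x^p)\le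 d_\epsilon(\mu,\delta_y^q)$ for all $y\in\Xi_n$, $q\in\Pi_n$ (such a minimizer exists); thus $d_\epsilon(\mu,\delta_\bullet^{\bullet,n})=\min_{x\in\Xi_n,\,p\in\Pi_n}d_\epsilon(\mu,\delta_x^p)$. Inverse measure: let $F_\mu^{-1}(t)=\sup\{y\in\mathbb{R}:F_\mu(y)\le t\}\in[-\infty,+\infty]$ for $t\in\mathbb{R}$ (with $\sup\varnothing=-\infty$); it is non-decreasing, right-continuous, and real-valued on $(0,1)$. The inverse measure $\mu^{-1}$ is the $\sigma$-finite positive Borel measure on $\mathbb{R}$ with $\mu^{-1}(\mathbb{R}\setminus(0,1))=0$ and $\mu^{-1}((x,y])=F_\mu^{-1}(y)-F_\mu^{-1}(x)$ for all $0<x\le y<1$. For a $\sigma$-finite Borel measure $\rho$ on $\mathbb{R}$, $\rho=\rho_{\sf A}+\rho_{\sf S}$ is the unique decomposition with $\rho_{\sf A}$ absolutely continuous and $\rho_{\sf S}$ singular with respect to $\lambda$. The function $\Omega:\mathbb{R}\to\mathbb{R}$ is $\Omega(x)=\dfrac{x}{2+2|x|}$. *)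

(* Defs.v *)
From HB Require Import structures.
From mathcomp Require Import all_boot all_order all_algebra.
From mathcomp Require Import all_classical all_reals all_analysis.
From mathcomp Require Import measurable_realfun.

Set Implicit Arguments.
Unset Strict Implicit.
Unset Printing Implicit Defensive.

Import Order.TTheory GRing.Theory Num.Theory.
Import numFieldNormedType.Exports.

Local Open Scope classical_set_scope.
Local Open Scope ring_scope.

Section levy.
Context {R : realType}.
Implicit Types mu nu : set (measurableTypeR R) -> \bar R.

(* The distribution functions and the Levy metric take bare set functions, so
   that they apply to [delta x p] without a proof that [p] is a weight vector;
   [delta_probability] below covers that case. *)
Definition dfun mu (x : R) : R := fine (mu `]-oo, x]%classic).

Definition dfun_left mu (x : R) : R := fine (mu `]-oo, x[%classic).

Definition levy_dist (eps : R) mu nu : R :=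
  inf [set y : R | 0 < y /\ forall x : R,
         dfun_left mu (x - y / eps) - y <= dfun nu x /\
         dfun nu x <= dfun mu (x + y / eps) + y].

Definition Xi (n : nat) : set 'rV[R]_n :=
  [set x | forall i j : 'I_n, (i <= j)%N -> x 0 i <= x 0 j].

Definition Pi (n : nat) : set 'rV[R]_n :=
  [set p | (forall j, 0 <= p 0 j) /\ \sum_(j < n) p 0 j = 1].

Definition delta (n : nat) (x p : 'rV[R]_n) :
    set (measurableTypeR R) -> \bar R :=
  fun A => (\sum_(j < n) (p ord0 j)%:E * \d_(x ord0 j) A)%E.

Lemma delta_probability n (x p : 'rV[R]_n) : Pi p ->
  exists P : probability (measurableTypeR R) R, delta x p = P.
Proof.
move=> [p0 p1].
have delta0 : delta x p set0 = 0%E.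
  by rewrite /delta big1// => j _; rewrite measure0 mule0.
have delta_ge0 A : (0 <= delta x p A)%E.
  by apply: sume_ge0 => j _; rewrite mule_ge0// lee_fin.
have delta_sa : semi_sigma_additive (delta x p).
  move=> F mF tF mUF.
  rewrite [X in X @ _ --> _](_ : _ = fun k =>
      (\sum_(j < n) (p ord0 j)%:E *
        \sum_(0 <= i < k) \d_(x ord0 j) (F i))%E); last first.
    apply/funext => k; rewrite exchange_big/=; apply: eq_bigr => j _.
    by rewrite ge0_sume_distrr.
  apply: cvg_nnesum => [j _|j _].
    by apply: nearW => k; rewrite mule_ge0 ?lee_fin// sume_ge0.
  apply: cvgeZl => //; exact: measure_semi_sigma_additive.
pose m := isMeasure.Build _ _ _ (delta x p) delta0 delta_ge0 delta_sa.
pose mm : {measure set _ -> \bar R} := HB.pack (delta x p) m.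
have mT : mm [set: _] = 1%E.
  rewrite /= /delta -(EFin_inj (congr1 EFin p1)).
  by rewrite -sumEFin; apply: eq_bigr => j _; rewrite diracT mule1.
pose mp := Measure_isProbability.Build _ _ _ mm mT.
pose P : probability (measurableTypeR R) R := HB.pack (mm : set _ -> \bar R) m mp.
by exists P.
Qed.

Definition best_approx (eps : R) mu (n : nat) (x p : 'rV[R]_n) : Prop :=
  [/\ Xi x, Pi p & forall y q : 'rV[R]_n, Xi y -> Pi q ->
      levy_dist eps mu (delta x p) <= levy_dist eps mu (delta y q)].

Definition Omega (x : R) : R := x / (2 + 2 * `|x|).

End levy.

Section inverse_measure.
Context {R : realType}.
Context (mu : probability (measurableTypeR R) R).

Definition dfun_inv (t : R) : \bar R :=
  ereal_sup [set y%:E | y in [set y : R | dfun mu y <= t]].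

Definition is_inverse_measure
    (nu : {sigma_finite_measure set (measurableTypeR R) -> \bar R}) : Prop :=
  nu (~` `]0, 1[%classic) = 0%E /\
  forall x y : R, 0 < x -> x <= y -> y < 1 ->
    nu `]x, y]%classic = (dfun_inv y - dfun_inv x)%E.

End inverse_measure.

(* Existence: push Lebesgue measure restricted to [{z | 0 < F z < 1}] forward by
   the distribution function [F] of [mu]. *)
Section inverse_measure_exists.
Context {R : realType} (mu : probability (measurableTypeR R) R).

Let idTR : measurableTypeR R -> R := idfun.
#[local] HB.instance Definition _ :=
  @isMeasurableFun.Build _ _ _ _ idTR (@measurable_id _ _ setT).

Let dfunE : dfun mu = fun r => fine (cdf (idTR : {RV mu >-> R}) r).
Proof. by []. Qed.

Let dfun_nd : nondecreasing_fun (dfun mu).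
Proof.
by move=> a b ab; rewrite dfunE/= fine_le ?fin_num_measure//; exact: cdf_nondecreasing.
Qed.

Let dfunNy : dfun mu @ -oo --> (0:R).
Proof. by rewrite dfunE; exact/fine_cvg/cvg_cdfNy0. Qed.

Let dfuny : dfun mu @ +oo --> (1:R).
Proof. by rewrite dfunE; exact/fine_cvg/cvg_cdfy1. Qed.

Let dfun_mfun : measurable_fun [set: measurableTypeR R] (dfun mu : _ -> measurableTypeR R).
Proof. exact: nondecreasing_measurable. Qed.

Let D := dfun mu @^-1` `]0, 1[%classic.

Let mD : @measurable _ (measurableTypeR R) D.
Proof. by rewrite -[D]setTI; apply: dfun_mfun => //; exact: measurable_itv. Qed.

Let nu := pushforward (mrestr (@lebesgue_measure R) mD) (dfun mu : _ -> measurableTypeR R).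

Let nu_m : {measure set (measurableTypeR R) -> \bar R} :=
  measure_function_pushforward__canonical__measure_function_Measure
    (mrestr (@lebesgue_measure R) mD) dfun_mfun.

Let dfun_inv_spec (t : R) : 0 < t -> t < 1 ->
  exists2 a : R, dfun_inv mu t = a%:E &
    forall z, (z < a -> dfun mu z <= t) /\ (dfun mu z <= t -> z <= a).
Proof.
move=> t0 t1; pose S := [set y : R | dfun mu y <= t].
have [a Sa] : exists a, S a.
  have /filter_ex[a /=] : \forall z \near -oo, dfun mu z <= t.
    by have /cvgr_le := dfunNy; apply.
  by exists a.
have [b Sb] : exists b, t < dfun mu b.
  have /filter_ex[b /=] : \forall z \near +oo, t < dfun mu z.
    by have /cvgr_gt := dfuny; apply.
  by exists b.
have ubS : ubound S b.
  by move=> z Sz; rewrite leNgt; apply/negP => /ltW/dfun_nd bz; have := lt_le_trans Sb (le_trans bz Sz); rewrite ltxx.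
have hS : has_sup S by split; [exists a | exists b].
exists (sup S); first by rewrite /dfun_inv ereal_sup_EFin//; case: hS.
move=> z; split => [|Sz]; last by apply: ub_le_sup Sz; case: hS.
move=> /(sup_gt hS.1) [y Sy zy]; exact: le_trans (dfun_nd (ltW zy)) Sy.
Qed.

Let nu_itv x y : 0 < x -> x <= y -> y < 1 ->
  nu `]x, y]%classic = (dfun_inv mu y - dfun_inv mu x)%E.
Proof.
move=> x0 xy y1.
have : (dfun_inv mu x <= dfun_inv mu y)%E.
  apply: le_ereal_sup => _ [z zx <-]; exists z => //=; exact: le_trans zx xy.
have [a -> aP] := dfun_inv_spec x0 (le_lt_trans xy y1).
have [b -> bP] := dfun_inv_spec (lt_le_trans x0 xy) y1.
rewrite lee_fin => ab.
rewrite /nu /pushforward /mrestr setIidl; last first.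
  move=> z; rewrite /D/= !in_itv/= => /andP[h1 h2].
  by rewrite (lt_trans x0 h1) (le_lt_trans h2 y1).
set S := _ @^-1` _.
have mS : @measurable _ (measurableTypeR R) S.
  by rewrite -[S]setTI; apply: dfun_mfun => //; exact: measurable_itv.
have SP z : S z <-> x < dfun mu z <= y by rewrite /S/= in_itv.
have leab (i j : bool) : lebesgue_measure ([set` Interval (BSide i a) (BSide j b)] : set (measurableTypeR R)) = (b%:E - a%:E)%E.
  rewrite lebesgue_measure_itv/= lte_fin; case: ltgtP ab => // -> _; by rewrite subee.
apply/eqP; rewrite eq_le -{1}(leab true false) -(leab false true); apply/andP; split.
  apply: le_measure; rewrite ?inE//.
  move=> z /SP /andP[h1 h2]; rewrite /= in_itv/= (bP z).2// andbT.
  by rewrite leNgt; apply/negP => /(aP z).1; rewrite leNgt h1.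
apply: le_measure; rewrite ?inE//.
move=> z; rewrite /= in_itv/= => /andP[h1 h2]; apply/SP.
rewrite (bP z).1// andbT ltNge; apply/negP => /(aP z).2.
by rewrite leNgt h1.
Qed.

Let nuC : nu (~` `]0, 1[%classic) = 0%E.
Proof. by rewrite /nu /pushforward /mrestr preimage_setC setICl measure0. Qed.

Let nu_sf : sigma_finite setT nu.
Proof.
pose F n := ~` `]0, 1[%classic `|` `](n.+2%:R^-1 : R), 1 - n.+2%:R^-1]%classic.
exists F.
  apply/esym; rewrite -subTset => z _.
  have [z01|] := boolP (z \in `]0, 1[); last by exists 0 => //; left; apply/negP.
  move: (z01); rewrite in_itv/= => /andP[z0 z1].
  have [n hn] : exists n : nat, n.+2%:R^-1 < z /\ n.+2%:R^-1 <= 1 - z.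
    have m0 : 0 < Num.min z (1 - z) by rewrite lt_min z0 subr_gt0.
    have [n _ /(_ n (leqnn n))] := near_infty_natSinv_lt (PosNum m0).
    rewrite /= lt_min => /andP[h1 h2]; exists n.
    have h : n.+2%:R^-1 <= n.+1%:R^-1 :> R by rewrite lef_pV2 ?posrE// ler_nat.
    by rewrite (le_lt_trans h h1) (le_trans h (ltW h2)).
  by exists n => //; right => /=; rewrite in_itv/= hn.1 lerBrDr addrC -lerBrDr hn.2.
move=> n; have mF : @measurable _ (measurableTypeR R) (F n).
  by apply: measurableU; [apply: measurableC|]; exact: measurable_itv.
split => //.
have n0 : 0 < n.+2%:R^-1 :> R by rewrite invr_gt0.
have n1 : 1 - n.+2%:R^-1 < 1 :> R by rewrite ltrBlDr ltrDl.
have nn : n.+2%:R^-1 <= 1 - n.+2%:R^-1 :> R.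
  rewrite lerBrDr -mulr2n -[X in X <= _]mulr_natr ler_pdivrMl// mulr1 ler_nat//.
pose I : set (measurableTypeR R) := `](n.+2%:R^-1 : R), 1 - n.+2%:R^-1]%classic.
pose C : set (measurableTypeR R) := ~` `]0, 1[%classic.
apply: (@le_lt_trans _ _ (nu C + nu I)%E).
  by apply: (measureU2 nu_m); [apply: measurableC|]; exact: measurable_itv.
rewrite nuC add0e /I nu_itv//.
have [a -> _] := dfun_inv_spec n0 (le_lt_trans nn n1).
have [b -> _] := dfun_inv_spec (lt_le_trans n0 nn) n1.
by rewrite -EFinB ltry.
Qed.

Lemma inverse_measure_exists :
  exists nu : {sigma_finite_measure set (measurableTypeR R) -> \bar R},
    is_inverse_measure mu nu.
Proof.
pose sf := Measure_isSigmaFinite.Build _ _ _ nu_m nu_sf.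
pose P : {sigma_finite_measure set (measurableTypeR R) -> \bar R} :=
  HB.pack (nu_m : set _ -> \bar R) nu_m sf.
by exists P; split; [exact: nuC|exact: nu_itv].
Qed.

End inverse_measure_exists.

Section lebesgue_decomposition.
Context d (T : measurableType d) (R : realType).

Definition mutually_singular (rho mu : {measure set T -> \bar R}) : Prop :=
  exists N : set T, [/\ measurable N, mu N = 0%E & rho (~` N) = 0%E].

Definition lebesgue_decomposition
    (mu rho rhoA rhoS : {measure set T -> \bar R}) : Prop :=
  [/\ forall A, measurable A -> rho A = (rhoA A + rhoS A)%E,
      rhoA `<< mu & mutually_singular rhoS mu].

(* The library's ['d rho '/d mu] only covers finite [rho]; a sigma-finite
   absolutely continuous [rho] still has a real-valued density, which is unique
   up to a [mu]-null set. *)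
Definition is_density (mu rho : {measure set T -> \bar R}) (f : T -> R) : Prop :=
  [/\ measurable_fun setT f, forall x, 0 <= f x &
      forall A, measurable A -> rho A = (\int[mu]_(x in A) (f x)%:E)%E].

End lebesgue_decomposition.

(* Main.v *)
Require Import Defs.
From HB Require Import structures.
From mathcomp Require Import all_boot all_order all_algebra.
From mathcomp Require Import all_classical all_reals all_analysis.
From mathcomp Require Import measurable_realfun lra ring.

Set Implicit Arguments.
Unset Strict Implicit.
Unset Printing Implicit Defensive.

Import Order.TTheory GRing.Theory Num.Theory.
Import numFieldNormedType.Exports.

Local Open Scope classical_set_scope.
Local Open Scope ring_scope.

(** Write F for the distribution function of mu, G for its inverse, nu for the
inverse measure, lam for Lebesgue measure, f for the density of the absolutely
continuous part of nu, and r = 1 / (1 + eps f).  Then Omega (eps f) is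
(1 - r) / 2, so the claim is that 2 n d_n tends to the integral c of 1 - r over
]0, 1].

The geometry is a statement about the levels of F.  Let P_0 = 0, ..., P_n be
the partial sums of the masses of an n-point measure.  They cut ]0, 1] into the
cells C_i = ]P_i, P_(i+1)].  The measure is within y of mu in the Levy metric
exactly when, up to boundary effects, G varies by at most 2 y / eps on every
core W_i = ]P_i + y, P_(i+1) - y], while C_i \ W_i has length at most 2 y
by construction ([feasible_quantile]).  Thus eps nu(W_i) <= 2 y and
lam(C_i \ W_i) <= 2 y.  Conversely a greedy choice of the levels makes both
quantities at least 2 y in each cell, until the level 1 is reached
([greedy_feasible], [greedy_saturated]).

If alpha is a constant a in [0, 1] on a cell, the convex combination
a eps nu(W_i) + (1 - a) lam(C_i \ W_i) is therefore bounded by 2 y, from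
above in the first case and from below in the second.  For a function alpha it
becomes the pairing
  eps int_(W_i) alpha dnu + int_(C_i \ W_i) (1 - alpha) dlam,
and the point of the proof is the weight w that equals r off a null set
carrying the singular part of nu, and 0 on that set: since
w eps dnu = eps f / (1 + eps f) dlam = (1 - w) dlam, its pairing does not
depend on W_i at all and equals the integral of 1 - r over C_i
([weight_exchange]).  Summing over the cells, c is compared with 2 y n in both
directions, once w has been replaced by a step function alpha close to it in
L1(lam + eps nu) on ]0, 1] ([step_fun_approx_unit]).  The step function is
constant on all cells but a number K that depends on the precision only
([sum_bad_cells]), so the error is the precision plus 2 y K
([cell_sum_upper], [cell_sum_lower]), and y tends to 0 like 1 / n. *)

(** * Approximation of Borel sets and functions by step functions *)

Section step_functions.
Context {R : realType}.

(** A step function with all its breakpoints in [s], described without a list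
of values: this form is stable under pointwise operations, by concatenating
the lists of breakpoints. *)
Definition step_off (T : Type) (s : seq R) (phi : R -> T) : Prop :=
  forall a b, a <= b -> (forall c, c \in s -> ~~ (a <= c <= b)) ->
    phi a = phi b.

Lemma step_off_cat (T1 T2 T : Type) (h : T1 -> T2 -> T) s1 s2
    (phi1 : R -> T1) (phi2 : R -> T2) :
  step_off s1 phi1 -> step_off s2 phi2 ->
  step_off (s1 ++ s2) (fun t => h (phi1 t) (phi2 t)).
Proof.
move=> h1 h2 a b ab cab.
rewrite (h1 a b ab) ?(h2 a b ab)// => c cs; apply: cab;
  by rewrite mem_cat cs ?orbT.
Qed.

(** Applied to sets, [step_off] reads a set as a [Prop]-valued function. *)
Definition step_approx (m : set (measurableTypeR R) -> \bar R)
    (A : set (measurableTypeR R)) : Prop :=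
  forall e : R, 0 < e -> exists U s,
    [/\ measurable U, step_off s U & (m (A `+` U) < e%:E)%E].

Variable m : {measure set (measurableTypeR R) -> \bar R}.
Hypothesis mT : (m setT < +oo)%E.

Let le_m (A B : set (measurableTypeR R)) : measurable A -> measurable B ->
  A `<=` B -> (m A <= m B)%E.
Proof. by move=> mA mB AB; apply: le_measure => //; rewrite inE. Qed.

Let measurableY (A B : set (measurableTypeR R)) :
  measurable A -> measurable B -> measurable (A `+` B).
Proof. by move=> mA mB; apply: measurableU; exact: measurableD. Qed.

Let step_approxU (A B : set (measurableTypeR R)) :
  measurable A -> measurable B ->
  step_approx m A -> step_approx m B -> step_approx m (A `|` B).
Proof.
move=> mA mB hA hB e e0.
have e2 : 0 < e / 2 by rewrite divr_gt0.
have [U [s [mU sU AU]]] := hA _ e2; have [V [t [mV tV BV]]] := hB _ e2.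
exists (U `|` V), (s ++ t); split; first exact: measurableU.
  exact: (step_off_cat or).
apply: (@le_lt_trans _ _ (m (A `+` U) + m (B `+` V))%E).
  apply: le_trans (measureU2 m (measurableY mA mU) (measurableY mB mV)).
  apply: le_m.
  - by apply: measurableY; exact: measurableU.
  - by apply: measurableU; exact: measurableY.
  rewrite /setY => z [[[Az|Bz] /not_orP[nU nV]]|[[Uz|Vz] /not_orP[nA nB]]];
    by [left; left|right; left|left; right|right; right].
by rewrite (splitr e) EFinD lteD.
Qed.

(** The sets that can be approximated form a sigma-algebra, because a countable
union is nearly exhausted, for a finite measure, by a finite one; and the open
rays, which generate the Borel sets, have a single breakpoint. *)
Lemma measurable_step_approx (A : set (measurableTypeR R)) :
  measurable A -> step_approx m A.
Proof.
pose C := [set B : set (measurableTypeR R) | measurable B /\ step_approx m B].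
suff h : <<s RGenOInfty.G (R:=R) >> `<=` C.
  move=> mA; have [] // : C A.
  have mE : measurable A = <<s RGenOInfty.G (R:=R) >> A.
    exact: (congr1 (@^~ A) (RGenOInfty.measurableE R)).
  by apply: h; rewrite -mE.
apply: smallest_sub; last first.
  move=> _ [a ->]; split; first exact: measurable_itv.
  move=> e e0; exists `]a, +oo[%classic, [:: a]; split.
  - exact: measurable_itv.
  - move=> u v uv /(_ a); rewrite mem_head => /(_ isT) nauv.
    apply/propext; rewrite /= !in_itv/= !andbT; split; first by move=> /lt_le_trans; exact.
    by move: nauv; rewrite negb_and -!ltNge => /orP[//|va /(lt_trans va)]; rewrite ltxx.
  - by rewrite /setY setDv setU0 measure0 lte_fin.
split.
- split => // e e0; exists set0, [::]; split => //.
  by rewrite /setY setDv setU0 measure0 lte_fin.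
- move=> B [mB hB]; split; first exact: measurableD.
  move=> e e0; have [U [s [mU sU BU]]] := hB _ e0.
  exists (~` U), s; split; first exact: measurableC.
    move=> a b ab cab; rewrite /setC/=; apply/propext.
    by have -> : U a = U b by exact: sU.
  rewrite setTD; congr (_ < _)%E: BU; congr (m _).
  rewrite /setY; apply/seteqP; split => z /=; rewrite /setD/=;
    have := EM (B z); have := EM (U z); tauto.
- move=> F hF; have mF n : measurable (F n) by have [] := hF n.
  have mUF := bigcup_measurable (fun n (_ : setT n) => mF n).
  split => // e e0.
  have e2 : 0 < e / 2 by rewrite divr_gt0.
  pose B n := \big[setU/set0]_(i < n) F i.
  have mB n : measurable (B n) by exact: bigsetU_measurable.
  have hB n : step_approx m (B n).
    elim: n => [|n IH]; rewrite /B.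
      rewrite big_ord0 => d d0; exists set0, [::]; split => //.
      by rewrite /setY setDv setU0 measure0 lte_fin.
    rewrite big_ord_recr; by apply: step_approxU IH (hF n).2; [exact: mB n|exact: mF n].
  have mD n : measurable (\bigcup_k F k `\` B n) by exact: measurableD.
  have : m (\bigcup_k F k `\` B n) @[n --> \oo] --> m (\bigcap_n (\bigcup_k F k `\` B n)).
    apply: nonincreasing_cvg_mu => //.
    - exact: le_lt_trans (le_m (mD 0%N) measurableT (@subsetT _ _)) mT.
    - by apply: bigcap_measurableType => n _; exact: mD.
    - move=> n k nk; apply/subsetPset; apply: setDS; exact: subset_bigsetU.
  rewrite (_ : \bigcap_n _ = set0) ?measure0; last first.
    apply/seteqP; split => // z zF; have [[k _ Fkz] _] := zF 0%N I.
    have [_] := zF k.+1 I; apply; rewrite /B big_ord_recr; by right.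
  move=> /fine_cvgP[_ /cvgrPdist_lt /(_ _ e2)] [n0 _ /(_ n0 (leqnn _))] /=.
  rewrite sub0r normrN ger0_norm ?fine_ge0// => hn.
  have {}hn : (m (\bigcup_n F n `\` B n0) < (e / 2)%:E)%E.
    rewrite -[ltLHS]fineK ?lte_fin// ge0_fin_numE//.
    exact: le_lt_trans (le_m (mD n0) measurableT (@subsetT _ _)) mT.
  have [U [s [mU sU BU]]] := hB n0 _ e2.
  exists U, s; split => //.
  apply: (@le_lt_trans _ _ (m (\bigcup_n F n `\` B n0) + m (B n0 `+` U))%E).
    apply: le_trans (measureU2 m (mD n0) (measurableY (mB n0) mU)).
    apply: le_m.
    - exact: measurableY.
    - by apply: measurableU (mD n0) _; exact: measurableY (mB n0) mU.
    rewrite /setY => z [[Fz nU]|[Uz nF]].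
      by have [Bz|nB] := pselect (B n0 z); [right; left|left].
    right; right; split => // Bz; apply: nF.
    by move: Bz; rewrite /B -bigcup_mkord => -[k _ Fkz]; exists k.
  by rewrite (splitr e) EFinD lteD.
Qed.

End step_functions.

Section step_function_density.
Context {R : realType}.

(** The number of the levels 0, ..., k - 1 strictly below [t] rounds [t] up: a
function with values in [0, k] is within 1 of the sum of the indicators of its
superlevel sets. *)
Lemma sum_levels (k : nat) (t : R) : 0 <= t <= k%:R ->
  t <= \sum_(i < k) (\1_[set u : R | i%:R < u] t) <= t + 1.
Proof.
elim: k => [|k IH] /andP[t0 tk].
  by rewrite big_ord0; apply/andP; split; lra.
have [tk'|tk'] := leP t k%:R.
  rewrite big_ord_recr/= indicE memNset/= ?addr0; last by rewrite ltNge tk'.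
  by apply: IH; rewrite t0.
rewrite (eq_bigr (fun=> 1)) ?sumr_const ?card_ord; last first.
  move=> i _; rewrite indicE mem_set//=; apply: le_lt_trans tk'.
  by rewrite ler_nat -ltnS.
by rewrite tk -natr1 lerD2r ltW.
Qed.

Lemma step_off_sum (n : nat) (s : 'I_n -> seq R) (h : 'I_n -> R -> R) :
  (forall i, step_off (s i) (h i)) ->
  exists t, step_off t (fun u => \sum_(i < n) h i u).
Proof.
elim: n s h => [|n IH] s h H.
  by exists [::] => a b _ _; rewrite !big_ord0.
have [|t ht] := IH (fun i => s (widen_ord (leqnSn n) i))
                   (fun i => h (widen_ord (leqnSn n) i)).
  by move=> i; exact: H.
exists (t ++ s ord_max) => a b ab cab.
rewrite !big_ord_recr/=.
by have := step_off_cat (fun u v => u + v) ht (H ord_max); apply.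
Qed.

Variable m : {measure set (measurableTypeR R) -> \bar R}.

(** Cut [phi] into the average of the indicators of its [k] superlevel sets, at a
uniform cost of 1 / k, and approximate each of these sets.  The average of the
approximating sets keeps its values in [0, 1]. *)
Lemma step_fun_approx (D : set (measurableTypeR R)) (phi : measurableTypeR R -> R) (e : R) :
  measurable D -> (m D < +oo)%E ->
  measurable_fun setT phi -> (forall t, 0 <= phi t <= 1) -> 0 < e ->
  exists (alpha : measurableTypeR R -> R) s,
    [/\ measurable_fun setT alpha, step_off s alpha,
        forall t, 0 <= alpha t <= 1 &
        (\int[m]_(t in D) (`|alpha t - phi t|)%:E < e%:E)%E].
Proof.
move=> mD mDoo mphi phi01 e0.
have mDfin : m D \is a fin_num by rewrite ge0_fin_numE.
have e2 : 0 < e / 2 by rewrite divr_gt0.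
have [k k0 hk] : exists2 k : nat, (0 < k)%N & fine (m D) / k%:R < e / 2.
  exists (Num.truncn (fine (m D) / (e / 2))).+1 => //.
  rewrite ltr_pdivrMr ?ltr0n// mulrC -ltr_pdivrMr//.
  by have /andP[] := @truncn_itv R (fine (m D) / (e / 2))
    (divr_ge0 (fine_ge0 (measure_ge0 m D)) (ltW e2)).
have kR : 0 < k%:R :> R by rewrite ltr0n.
pose A (i : 'I_k) : set (measurableTypeR R) := [set t | i%:R < k%:R * phi t].
have mkphi : measurable_fun setT (fun t => k%:R * phi t).
  by apply: measurable_funM => //; exact: measurable_cst.
have mA i : measurable (A i).
  rewrite -[A i]setTI; have := mkphi measurableT `]i%:R, +oo[%classic (measurable_itv _).
  by congr (measurable (_ `&` _)); apply/seteqP; split => t; rewrite /A/= in_itv/= andbT.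
pose mr : {measure set (measurableTypeR R) -> \bar R} := mrestr m mD.
have mrT : (mr setT < +oo)%E by rewrite /mr/= /mrestr setTI.
have /choice[U /choice[s Us]] : forall i, exists U s,
    [/\ measurable U, step_off s U & (m ((A i `+` U) `&` D) < (e / 2)%:E)%E].
  by move=> i; exact: measurable_step_approx mrT _ (mA i) _ e2.
pose alpha (t : measurableTypeR R) := k%:R^-1 * \sum_(i < k) (\1_(U i) t : R).
have malpha : measurable_fun setT alpha.
  apply: measurable_funM; first exact: measurable_cst.
  by apply: measurable_sum => i; apply: measurable_indic; have [] := Us i.
have [t0 ht0] : exists t, step_off t (fun u => \sum_(i < k) (\1_(U i) u : R)).
  apply: (step_off_sum (s := s)) => i a b ab cab.
  have [_ /(_ a b ab cab) Uab _] := Us i.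
  suff e' : (a \in U i) = (b \in U i) by rewrite !indicE e'.
  by apply/idP/idP; rewrite !inE Uab.
have mAU i : measurable (A i `+` U i).
  by have [mU _ _] := Us i; apply: measurableU; exact: measurableD.
(* uniform rounding error plus the errors made on the superlevel sets *)
pose bnd (t : measurableTypeR R) : \bar R :=
  (k%:R^-1%:E + \sum_(i < k) (k%:R^-1)%:E * (\1_(A i `+` U i) t)%:E)%E.
exists alpha, t0; split => //.
- by move=> a b ab cab; rewrite /alpha (ht0 a b).
- move=> t; rewrite /alpha; apply/andP; split.
    by apply: mulr_ge0; [rewrite invr_ge0 ltW|exact: sumr_ge0].
  rewrite mulrC ler_pdivrMr// mul1r.
  apply: (@le_trans _ _ (\sum_(i < k) (1 : R))); last by rewrite sumr_const card_ord.
  by apply: ler_sum => i _; rewrite indicE lern1; case: (_ \in _).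
have mind i : measurable_fun D (fun t : measurableTypeR R => (\1_(A i `+` U i) t : R)%:E).
  by apply/measurable_EFinP; exact: measurable_indic.
have mki i : measurable_fun D (fun t : measurableTypeR R => (k%:R^-1)%:E * (\1_(A i `+` U i) t : R)%:E)%E.
  by apply: emeasurable_funM => //; exact: measurable_cst.
apply: (@le_lt_trans _ _ (\int[m]_(t in D) bnd t)%E).
  apply: ge0_le_integral => //.
  - apply/measurable_EFinP; apply: measurableT_comp; first exact: normr_measurable.
    by apply: measurable_funTS; exact: measurable_funB.
  - apply: emeasurable_funD; first exact: measurable_cst.
    exact: emeasurable_sum.
  - move=> t _; rewrite /bnd.
    under eq_bigr do rewrite -EFinM.
    rewrite sumEFin -EFinD lee_fin.
    have /sum_levels : 0 <= k%:R * phi t <= k%:R.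
      have /andP[p0 p1] := phi01 t.
      by rewrite mulr_ge0 ?(ltW kR)//= ler_piMr// ltW.
    set S := \sum_(i < k) _ => /andP[S1 S2].
    have -> : alpha t - phi t = k%:R^-1 * (\sum_(i < k) \1_(U i) t - S) + (k%:R^-1 * S - phi t).
      by rewrite /alpha; ring.
    rewrite addrC; apply: le_trans (ler_normD _ _) _; apply: lerD; last first.
      rewrite normrM ger0_norm ?invr_ge0 ?(ltW kR)// -mulr_sumr ler_wpM2l ?invr_ge0 ?(ltW kR)//.
      rewrite /S -sumrB; apply: le_trans (ler_norm_sum _ _ _) _.
      apply: ler_sum => i _; rewrite !indicE.
      have -> : (k%:R * phi t \in [set u : R | i%:R < u]) = (t \in A i).
        by apply/idP/idP; rewrite !inE.
      case: (boolP (t \in U i)) => tU; case: (boolP (t \in A i)) => tA;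
        rewrite ?subrr ?normr0 ?ler0n// ?subr0 ?sub0r ?normrN normr1.
        rewrite mem_set//; right; split; first exact: set_mem.
        by move=> /mem_set; exact/negP.
      rewrite mem_set//; left; split; first exact: set_mem.
      by move=> /mem_set; exact/negP.
    have -> : k%:R^-1 * S - phi t = k%:R^-1 * (S - k%:R * phi t).
      by rewrite mulrBr mulKf// gt_eqF.
    rewrite normrM !ger0_norm ?subr_ge0 ?invr_ge0 ?(ltW kR)//.
    by rewrite ler_piMr ?invr_ge0 ?(ltW kR)// lerBlDl.
rewrite ge0_integralD//; last 2 first.
- by move=> t _; apply: sume_ge0 => i _; rewrite mule_ge0// lee_fin ?invr_ge0 ?(ltW kR).
- exact: emeasurable_sum.
rewrite integral_cst// ge0_integral_sum//.
under eq_bigr => i _.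
  rewrite ge0_integralZl_EFin//.
  rewrite integral_indic//; over.
apply: (@le_lt_trans _ _ ((fine (m D) / k%:R)%:E + (e / 2)%:E)%E).
  apply: leeD; first by rewrite -[X in (_ * X)%E]fineK// -EFinM mulrC.
  apply: (@le_trans _ _ (\sum_(i < k) (k%:R^-1 * (e / 2))%:E)%E).
    apply: lee_sum => i _; rewrite EFinM lee_pmul2l ?lte_fin ?invr_gt0//.
    by have [_ _ /ltW] := Us i.
  by rewrite sumEFin sumr_const card_ord -[_ *+ k]mulr_natl mulVKf// gt_eqF.
by rewrite -EFinD lte_fin {2}(splitr e) ltrD2r.
Qed.

End step_function_density.

Section unit_interval_approx.
Context {R : realType}.
Variable m : {measure set (measurableTypeR R) -> \bar R}.

(** The measure may be infinite near 0 and 1, as the inverse measure of a law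
with unbounded support is.  Integrability of [phi] allows cutting it off near
these two points; the cut-off is itself a step function.  At the point 1, which
belongs to no cut-off interval, [phi] has to vanish. *)
Lemma step_fun_approx_unit (phi : measurableTypeR R -> R) (e : R) :
  (forall a b : R, 0 < a -> a <= b -> b < 1 -> (m `]a, b]%classic < +oo)%E) ->
  measurable_fun setT phi -> (forall t, 0 <= phi t <= 1) -> phi 1 = 0 ->
  (\int[m]_(t in `]0%R, 1%R]) (phi t)%:E < +oo)%E -> 0 < e ->
  exists (alpha : measurableTypeR R -> R) s,
    [/\ measurable_fun setT alpha, step_off s alpha,
        forall t, 0 <= alpha t <= 1 &
        (\int[m]_(t in `]0%R, 1%R]) (`|alpha t - phi t|)%:E < e%:E)%E].
Proof.
move=> moo mphi phi01 phi1 iphi e0.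
have e2 : 0 < e / 2 by rewrite divr_gt0.
pose u (k : nat) : R := k.+2%:R^-1.
have u0 k : 0 < u k by rewrite invr_gt0.
have u1 k : u k <= 1 - u k.
  rewrite lerBrDr -mulr2n -[X in X <= _]mulr_natr ler_pdivrMl// mulr1 ler_nat//.
have u2 k : 1 - u k < 1 by rewrite ltrBlDr ltrDl.
pose D : set (measurableTypeR R) := `]0, 1]%classic.
pose I k : set (measurableTypeR R) := `](u k), (1 - u k)]%classic.
have mD : measurable D by exact: measurable_itv.
have mI k : measurable (I k) by exact: measurable_itv.
have ID k : I k `<=` D.
  move=> t; rewrite /I /D/= !in_itv/= => /andP[h1 h2].
  by rewrite (lt_trans (u0 k) h1) (le_trans h2 (ltW (u2 k))).
pose F k (t : measurableTypeR R) : \bar R := (phi t * \1_(I k) t)%:E.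
have mF k : measurable_fun D (F k).
  apply/measurable_EFinP; apply: measurable_funTS.
  by apply: measurable_funM; [exact: mphi|exact: measurable_indic].
have mphiD : measurable_fun D (EFin \o phi).
  by apply/measurable_EFinP; exact: measurable_funTS.
have phi0 t : 0 <= phi t by have /andP[] := phi01 t.
have [_ + _] : [/\ m.-integrable D (EFin \o phi),
    [sequence (\int[m]_(x in D) `|F n x - (EFin \o phi) x|)%E]_n @ \oo --> 0%E &
    [sequence (\int[m]_(x in D) (F n x))%E]_n @ \oo --> (\int[m]_(x in D) (EFin \o phi) x)%E].
  apply: (@dominated_convergence _ _ _ _ _ mD _ _ (EFin \o phi)) => //.
  - apply: aeW => t; rewrite /D/= in_itv/= => /andP[t0 t1].
    move: t1; rewrite le_eqVlt => /orP[/eqP ->|t1].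
      rewrite /F phi1; under eq_fun do rewrite mul0r; exact: cvg_cst.
    apply: cvg_near_cst.
    have m0 : 0 < Num.min t (1 - t) by rewrite lt_min t0 subr_gt0.
    have := near_infty_natSinv_lt (PosNum m0); apply: filterS => k /=.
    rewrite lt_min => /andP[h1 h2].
    have h : u k <= k.+1%:R^-1 by rewrite lef_pV2 ?posrE// ler_nat.
    rewrite /F indicE mem_set ?mulr1// /I/= in_itv/= (le_lt_trans h h1)/=.
    by rewrite lerBrDr addrC -lerBrDr (le_trans h (ltW h2)).
  - apply/integrableP; split => //.
    by under eq_integral do rewrite /= ger0_norm//.
  - apply: aeW => t k _; rewrite /F/= lee_fin ger0_norm ?mulr_ge0//.
    by rewrite ler_piMr// indicE lern1; case: (_ \in _).
move=> /fine_cvgP[fin /cvgrPdist_lt /(_ _ e2)] c.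
have [k _ /(_ k (leqnn _)) [kfin hk]] : \forall k \near \oo,
    (\int[m]_(x in D) `|F k x - (EFin \o phi) x|)%E \is a fin_num /\
    `|0 - fine (\int[m]_(x in D) `|F k x - (EFin \o phi) x|)%E| < e / 2.
  by near=> k; split; near: k; [exact: fin|exact: c].
move: hk; rewrite sub0r normrN ger0_norm; last first.
  by rewrite fine_ge0// integral_ge0.
move=> hk.
have {hk}hk : (\int[m]_(x in D) `|F k x - (EFin \o phi) x| < (e / 2)%:E)%E.
  by rewrite -(fineK kfin) lte_fin.
have [alpha [s [malpha salpha alpha01 ha]]] :=
  step_fun_approx (mI k) (moo _ _ (u0 k) (u1 k) (u2 k)) mphi phi01 e2.
pose beta t := alpha t * \1_(I k) t.
exists beta, ([:: u k; 1 - u k] ++ s).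
have mbeta : measurable_fun setT beta.
  by apply: measurable_funM => //; exact: measurable_indic.
split => //.
- apply: (step_off_cat (phi1 := \1_(I k)) (phi2 := alpha) (fun a b => b * a)) => //.
  move=> a b ab cab; rewrite !indicE; congr (nat_of_bool _)%:R.
  have := cab (u k); rewrite inE eqxx/= => /(_ isT) c1.
  have := cab (1 - u k); rewrite !inE eqxx orbT/= => /(_ isT) c2.
  apply/idP/idP; rewrite !inE /I/= !in_itv/= => /andP[h1 h2]; apply/andP; split.
  + exact: lt_le_trans ab.
  + by move: c2; rewrite h2 -ltNge => /ltW.
  + by move: c1; rewrite negb_and -!ltNge => /orP[//|/(lt_trans h1)]; rewrite ltxx.
  + exact: le_trans h2.
- move=> t; rewrite /beta indicE; have := alpha01 t.
  by case: (_ \in _); rewrite ?mulr1 ?mulr0 ?lexx ?ler01.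
have mn h : measurable_fun setT h -> measurable_fun D (fun t => (`|h t : R|)%:E).
  move=> mh; apply/measurable_EFinP; apply: measurableT_comp; first exact: normr_measurable.
  exact: measurable_funTS.
have mi h : measurable_fun D h -> measurable_fun D (fun t => h t * (\1_(I k) t)%:E)%E.
  move=> mh; apply: emeasurable_funM => //; apply/measurable_EFinP.
  exact: measurable_indic.
apply: (@le_lt_trans _ _ (\int[m]_(t in D)
   ((`|alpha t - phi t|)%:E * (\1_(I k) t)%:E + `|F k t - (EFin \o phi) t|))%E).
  apply: ge0_le_integral => //.
  - by apply: mn; exact: measurable_funB.
  - apply: emeasurable_funD.
      by apply: mi; apply: mn; exact: measurable_funB.
    apply: measurableT_comp => //; exact: emeasurable_funB.
  - move=> t _; rewrite /F /beta /= -EFinM -EFinD lee_fin indicE.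
    by case: (_ \in _); rewrite !(mulr1, mulr0, subrr, normr0, addr0, add0r, sub0r).
rewrite ge0_integralD//; last 2 first.
- by apply: mi; apply: mn; exact: measurable_funB.
- by apply: measurableT_comp => //; exact: emeasurable_funB.
rewrite (splitr e) EFinD lteD//.
rewrite (_ : (\int[m]_(t in D) _)%E = (\int[m]_(t in I k) (`|alpha t - phi t|)%:E)%E)//.
rewrite -[I k](setIidr (ID k)) integral_mkcondr.
by apply: eq_integral => t _; rewrite epatch_indic/= setIidr.
Unshelve. all: end_near.
Qed.

End unit_interval_approx.

(** * Integration against a measure with a density *)

Section density.
Context d (T : measurableType d) (R : realType).
Variables (mu rho : {measure set T -> \bar R}) (f : T -> R).
Hypothesis rhof : is_density mu rho f.

Import HBNNSimple.

Let mf : measurable_fun setT f. Proof. by case: rhof. Qed.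
Let f0 x : 0 <= f x. Proof. by case: rhof. Qed.

Let integral_density_nnsfun (D : set T) (h : {nnsfun T >-> R}) : measurable D ->
  (\int[rho]_(x in D) (h x)%:E = \int[mu]_(x in D) (h x * f x)%:E)%E.
Proof.
move=> mD.
have mh r : measurable (h @^-1` [set r]) by exact: measurable_sfunP.
have hsum x g : (\sum_(r \in range h) (r * \1_(h @^-1` [set r]) x * g)%:E = (h x * g)%:E :> \bar R)%E.
  by rewrite fsumEFin// fimfunE fsbig_finite//= [in RHS]fsbig_finite//= mulr_suml.
transitivity (\int[rho]_(x in D) (\sum_(r \in range h) (r * \1_(h @^-1` [set r]) x)%:E))%E.
  by apply: eq_integral => x _; rewrite fimfunE -fsumEFin.
have hr r : range h r -> 0 <= r by move=> [x _ <-].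
have ri0 r x : 0 <= r * \1_(h @^-1` [set r]) x by exact: nnfun_muleindic_ge0.
rewrite ge0_integral_fsum//; last 2 first.
- by move=> r; apply/measurable_EFinP; apply: measurable_funM => //; exact: measurable_indic.
- by move=> r x _; rewrite lee_fin.
under [RHS]eq_integral => x _ do rewrite -hsum.
rewrite ge0_integral_fsum//; last 2 first.
- move=> r; apply/measurable_EFinP; apply: measurable_funM => //; last exact: measurable_funTS.
  by apply: measurable_funM => //; exact: measurable_indic.
- by move=> r x _; rewrite lee_fin mulr_ge0.
apply: eq_fsbigr => r; rewrite inE => /hr r0.
under eq_integral do rewrite EFinM.
under [RHS]eq_integral do rewrite -mulrA EFinM.
rewrite !ge0_integralZl_EFin//.
- congr (_ * _)%E; rewrite integral_indic//.
  have [_ _ ->] := rhof; last exact: measurableI.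
  rewrite setIC integral_mkcondr; apply: eq_integral => x _.
  by rewrite epatch_indic/= EFinM muleC.
- by move=> x _; rewrite lee_fin mulr_ge0.
- apply/measurable_EFinP; apply: measurable_funM; last exact: measurable_funTS.
  exact: measurable_indic.
- by apply/measurable_EFinP; exact: measurable_indic.
Qed.

(** By monotone convergence from simple functions, so that infinite measures such
as the inverse measure of a law with unbounded support are covered. *)
Lemma integral_density (D : set T) (phi : T -> R) : measurable D ->
  measurable_fun setT phi -> (forall x, 0 <= phi x) ->
  (\int[rho]_(x in D) (phi x)%:E = \int[mu]_(x in D) (phi x * f x)%:E)%E.
Proof.
move=> mD mphi phi0.
have mphiE : measurable_fun setT (EFin \o phi) by exact/measurable_EFinP.
pose h := nnsfun_approx measurableT mphiE.
have nd_h n k x : (n <= k)%N -> h n x <= h k x.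
  by move=> nk; have /lefP := nd_nnsfun_approx measurableT mphiE nk; exact.
have hphi x : (h n x)%:E @[n --> \oo] --> (phi x)%:E.
  by apply: (@cvg_nnsfun_approx _ _ _ _ measurableT _ mphiE) => // z _; rewrite lee_fin.
have H1 : (\int[rho]_(x in D) (h n x)%:E)%E @[n --> \oo] --> (\int[rho]_(x in D) (phi x)%:E)%E.
  rewrite (_ : (\int[rho]_(x in D) (phi x)%:E)%E =
      (\int[rho]_(x in D) (limn (fun n => (h n x)%:E)))%E).
    apply: cvg_monotone_convergence => //.
    - by move=> n; apply/measurable_EFinP; apply: measurable_funTS.
    - by move=> n x _; rewrite lee_fin.
    - by move=> x _ n k nk; rewrite lee_fin nd_h.
  by apply: eq_integral => x _; apply/esym/cvg_lim.
have H2 : (\int[mu]_(x in D) (h n x * f x)%:E)%E @[n --> \oo] -->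
    (\int[mu]_(x in D) (phi x * f x)%:E)%E.
  rewrite (_ : (\int[mu]_(x in D) (phi x * f x)%:E)%E =
      (\int[mu]_(x in D) (limn (fun n => (h n x * f x)%:E)))%E).
    apply: cvg_monotone_convergence => //.
    - move=> n; apply/measurable_EFinP; apply: measurable_funTS.
      exact: measurable_funM.
    - by move=> n x _; rewrite lee_fin mulr_ge0.
    - by move=> x _ n k nk; rewrite lee_fin ler_wpM2r// nd_h.
  apply: eq_integral => x _; apply/esym/cvg_lim => //.
  under eq_fun do rewrite EFinM.
  by rewrite EFinM; apply: cvgeZr.
move: H1; under eq_fun do rewrite integral_density_nnsfun//.
by move=> H1; exact: (cvg_unique _ H1 H2).
Qed.

End density.

(** * The weight and the exchange identity *)

Section weight.
Context {R : realType}.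
Let lam : {measure set (measurableTypeR R) -> \bar R} := @lebesgue_measure R.
Variables (eps : R) (nu nuA nuS : {measure set (measurableTypeR R) -> \bar R}).
Variables (f : measurableTypeR R -> R) (N : set (measurableTypeR R)).
Hypotheses (eps0 : 0 < eps)
  (nuAS : forall A, measurable A -> nu A = (nuA A + nuS A)%E)
  (nuAf : is_density lam nuA f)
  (mN : measurable N) (lamN : lam N = 0%E) (nuSN : nuS (~` N) = 0%E).

Let mf : measurable_fun setT f. Proof. by case: nuAf. Qed.
Let f0 t : 0 <= f t. Proof. by case: nuAf. Qed.

Definition resolvent (t : measurableTypeR R) : R := (1 + eps * f t)^-1.

(** [N] is meant to be a null set carrying the singular part: the weight charges
the absolutely continuous part of the measure only. *)
Definition weight (t : measurableTypeR R) : R := resolvent t * \1_(~` N) t.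

Let g0 t : 0 <= eps * f t. Proof. by rewrite mulr_ge0// ltW. Qed.

Lemma resolvent01 t : 0 <= resolvent t <= 1.
Proof.
have g1 : 1 <= 1 + eps * f t by rewrite lerDl.
by rewrite invr_ge0 (le_trans ler01 g1)/= invf_le1// (lt_le_trans ltr01).
Qed.

Lemma measurable_resolvent : measurable_fun setT resolvent.
Proof.
pose h (u : R) : R := (1 + Num.max u 0)^-1.
rewrite (_ : resolvent = h \o (fun t => eps * f t)); last first.
  by apply/funext => t; rewrite /h/= max_l.
apply: measurableT_comp; last by apply: measurable_funM => //; exact: measurable_cst.
apply: nonincreasing_measurable => // u v uv; rewrite /h.
have p (w : R) : 0 < 1 + Num.max w 0 by rewrite ltr_pwDl// le_max lexx orbT.
by rewrite lef_pV2 ?posrE// lerD2l ge_max !le_max uv lexx !orbT.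
Qed.

Lemma weight01 t : 0 <= weight t <= 1.
Proof.
have /andP[r0 r1] := resolvent01 t; rewrite /weight indicE.
by case: (_ \in _); rewrite ?mulr1 ?mulr0 ?r0 ?r1 ?lexx ?ler01.
Qed.

Lemma measurable_weight : measurable_fun setT weight.
Proof.
apply: measurable_funM; first exact: measurable_resolvent.
by apply: measurable_indic; exact: measurableC.
Qed.

(** The singular part lives on [N], where the weight is 0. *)
Let integral_weight (W : set (measurableTypeR R)) : measurable W ->
  (eps%:E * \int[nu]_(t in W) (weight t)%:E =
   \int[lam]_(t in W) (1 - resolvent t)%:E)%E.
Proof.
move=> mW.
have mNC : measurable (~` N) by exact: measurableC.
have key (m : {measure set (measurableTypeR R) -> \bar R}) :
    (\int[m]_(t in W) (weight t)%:E =
     \int[m]_(t in W `&` ~` N) (resolvent t)%:E)%E.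
  rewrite integral_mkcondr; apply: eq_integral => t _.
  by rewrite epatch_indic.
rewrite key (@eq_measure_integral _ _ _ _ nuA); last first.
  move=> A mA AW; rewrite nuAS// (_ : nuS A = 0%E) ?adde0//.
  apply/eqP; rewrite eq_le measure_ge0 andbT -nuSN.
  by apply: le_measure; rewrite ?inE// => t /AW[].
rewrite (integral_density nuAf); last first.
- by move=> t; have /andP[] := resolvent01 t.
- exact: measurable_resolvent.
- exact: measurableI.
rewrite -ge0_integralZl_EFin ?(ltW eps0)//; last 3 first.
- exact: measurableI.
- by move=> t _; rewrite lee_fin mulr_ge0//; have /andP[] := resolvent01 t.
- apply/measurable_EFinP; apply: measurable_funTS; apply: measurable_funM => //.
  exact: measurable_resolvent.
rewrite -setDE [RHS](@ge0_negligible_integral _ _ _ _ _ N)//; last 2 first.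
- apply/measurable_EFinP; apply: measurable_funTS.
  by apply: measurable_funB; [exact: measurable_cst|exact: measurable_resolvent].
- by move=> t _; rewrite lee_fin subr_ge0; have /andP[] := resolvent01 t.
apply: eq_integral => t _; rewrite -EFinM; congr EFin.
have e : 1 + eps * f t != 0 by rewrite gt_eqF// ltr_pwDl.
by rewrite /resolvent; field.
Qed.

Let m_resolvent D : measurable_fun D (fun t => (1 - resolvent t)%:E).
Proof.
apply/measurable_EFinP; apply: measurable_funTS.
by apply: measurable_funB; [exact: measurable_cst|exact: measurable_resolvent].
Qed.

Let resolvent_ge0 t : (0 <= (1 - resolvent t)%:E)%E.
Proof. by rewrite lee_fin subr_ge0; have /andP[] := resolvent01 t. Qed.

(** On the carrier of the absolutely continuous part, eps w dnu and (1 - w) dlam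
are the same measure (1 - r) dlam, because eps f r = 1 - r; so moving a set from
one integral to the other changes nothing, and [W] disappears. *)
Lemma weight_exchange (C W : set (measurableTypeR R)) :
  measurable C -> measurable W -> W `<=` C ->
  (eps%:E * \int[nu]_(t in W) (weight t)%:E +
     \int[lam]_(t in C `\` W) (1 - weight t)%:E =
   \int[lam]_(t in C) (1 - resolvent t)%:E)%E.
Proof.
move=> mC mW WC; rewrite integral_weight//.
have mCW : measurable (C `\` W) by exact: measurableD.
rewrite (_ : \int[lam]_(t in C `\` W) (1 - weight t)%:E =
             \int[lam]_(t in C `\` W) (1 - resolvent t)%:E)%E; last first.
  rewrite [LHS](@ge0_negligible_integral _ _ _ _ _ N)//; last 2 first.
  - apply/measurable_EFinP; apply: measurable_funTS.
    by apply: measurable_funB; [exact: measurable_cst|exact: measurable_weight].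
  - by move=> t _; rewrite lee_fin subr_ge0; have /andP[] := weight01 t.
  rewrite [RHS](@ge0_negligible_integral _ _ _ _ _ N)//.
  apply: eq_integral => t; rewrite inE => -[_ Nt].
  by rewrite /weight indicE mem_set// mulr1.
rewrite -ge0_integral_setU//.
- by rewrite setDUK.
- by apply/disj_setPS => t [Wt [_]].
Qed.

Lemma weight_finite (D : set (measurableTypeR R)) : measurable D ->
  (lam D < +oo)%E -> (\int[nu]_(t in D) (weight t)%:E < +oo)%E.
Proof.
move=> mD Doo.
have : (eps%:E * \int[nu]_(t in D) (weight t)%:E < +oo)%E.
  rewrite integral_weight//.
  apply: (@le_lt_trans _ _ (\int[lam]_(t in D) (cst 1 t))%E).
    apply: ge0_le_integral => //.
    by move=> t _; rewrite lee_fin gerBl; have /andP[] := resolvent01 t.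
  by rewrite integral_cst// mul1e.
rewrite !ltey; apply: contra => /eqP ->.
by rewrite gt0_muley// lte_fin.
Qed.

End weight.

(** * Pairings summed over the cells of a subdivision *)

Section pairing.
Context {R : realType}.
Let lam : {measure set (measurableTypeR R) -> \bar R} := @lebesgue_measure R.
Variables (eps : R) (nu : {measure set (measurableTypeR R) -> \bar R}).
Hypothesis eps0 : 0 < eps.

Definition pairing (phi : measurableTypeR R -> R)
    (C W : set (measurableTypeR R)) : \bar R :=
  (eps%:E * \int[nu]_(t in W) (phi t)%:E +
     \int[lam]_(t in C `\` W) (1 - phi t)%:E)%E.

Definition error (phi psi : measurableTypeR R -> R)
    (C : set (measurableTypeR R)) : \bar R :=
  (eps%:E * \int[nu]_(t in C) (`|phi t - psi t|)%:E +
     \int[lam]_(t in C) (`|phi t - psi t|)%:E)%E.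

Lemma error_sym phi psi C : error phi psi C = error psi phi C.
Proof.
by congr (_ * _ + _)%E; apply: eq_integral => t _; rewrite distrC.
Qed.

Lemma pairing_le_error (phi psi : measurableTypeR R -> R)
    (C W : set (measurableTypeR R)) :
  measurable_fun setT phi -> measurable_fun setT psi ->
  (forall t, 0 <= phi t <= 1) -> (forall t, 0 <= psi t <= 1) ->
  measurable C -> measurable W -> W `<=` C ->
  (pairing phi C W <= pairing psi C W + error phi psi C)%E.
Proof.
move=> mphi mpsi phi01 psi01 mC mW WC.
have mCW : measurable (C `\` W) by exact: measurableD.
have md D : measurable_fun D (fun t => (`|phi t - psi t| : R)%:E).
  apply/measurable_EFinP; apply: measurable_funTS.
  by apply: measurableT_comp; [exact: normr_measurable|exact: measurable_funB].
have mE h D : measurable_fun setT h -> measurable_fun D (fun t : measurableTypeR R => (h t : R)%:E).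
  by move=> mh; apply/measurable_EFinP; exact: measurable_funTS.
have m1 (h : measurableTypeR R -> R) : measurable_fun setT h ->
    measurable_fun setT (fun t : measurableTypeR R => 1 - h t : R).
  by move=> mh; apply: measurable_funB => //; exact: measurable_cst.
rewrite /pairing /error addeACA; apply: leeD.
- rewrite -ge0_muleDr ?integral_ge0//; last first.
    by move=> t _; rewrite lee_fin; have /andP[] := psi01 t.
  rewrite lee_pmul2l ?lte_fin//.
  apply: (@le_trans _ _ (\int[nu]_(t in W) ((psi t)%:E + (`|phi t - psi t|)%:E))%E).
    apply: ge0_le_integral => //.
    + by move=> t _; rewrite lee_fin; have /andP[] := phi01 t.
    + exact: mE.
    + by apply: emeasurable_funD => //; exact: mE.
    + by move=> t _; rewrite -EFinD lee_fin -lerBlDl ler_norm.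
  rewrite ge0_integralD//; [|by move=> t _; rewrite lee_fin; have /andP[] := psi01 t|exact: mE].
  by rewrite leeD2l//; exact: ge0_subset_integral.
- apply: (@le_trans _ _ (\int[lam]_(t in C `\` W) ((1 - psi t)%:E + (`|phi t - psi t|)%:E))%E).
    apply: ge0_le_integral => //.
    + by move=> t _; rewrite lee_fin subr_ge0; have /andP[] := phi01 t.
    + by apply: mE; exact: m1.
    + by apply: emeasurable_funD => //; apply: mE; exact: m1.
    + move=> t _; rewrite -EFinD lee_fin -lerBlDl.
      rewrite (_ : _ - _ = psi t - phi t); last by ring.
      by rewrite distrC ler_norm.
  rewrite ge0_integralD//; last 2 first.
    + by move=> t _; rewrite lee_fin subr_ge0; have /andP[] := psi01 t.
    + by apply: mE; exact: m1.
  rewrite leeD2l//; apply: ge0_subset_integral => //; exact: subDsetl.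
Qed.

(** Where [phi] is a constant [a], the pairing is a convex combination of the two
quantities that the Levy distance controls. *)
Lemma pairing_cst (a : R) (phi : measurableTypeR R -> R) (C W : set (measurableTypeR R)) :
  measurable C -> measurable W -> W `<=` C -> (forall t, C t -> phi t = a) ->
  (pairing phi C W = a%:E * (eps%:E * nu W) + (1 - a)%:E * lam (C `\` W))%E.
Proof.
move=> mC mW WC phia; rewrite /pairing.
rewrite (@eq_integral _ _ _ nu W (cst a%:E)); last first.
  by move=> t; rewrite inE => /WC/phia ->.
rewrite (@eq_integral _ _ _ lam (C `\` W) (cst (1 - a)%:E)); last first.
  by move=> t; rewrite inE => -[/phia -> _].
by rewrite !integral_cst//; [rewrite muleCA|exact: measurableD].
Qed.

Lemma pairing_le1 (phi : measurableTypeR R -> R) (C W : set (measurableTypeR R)) :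
  measurable_fun setT phi -> (forall t, 0 <= phi t <= 1) ->
  measurable C -> measurable W ->
  (pairing phi C W <= eps%:E * nu W + lam (C `\` W))%E.
Proof.
move=> mphi phi01 mC mW; rewrite /pairing.
have mCW : measurable (C `\` W) by exact: measurableD.
apply: leeD.
  rewrite lee_pmul2l ?lte_fin// -[leRHS]mul1e -integral_cst//.
  apply: ge0_le_integral => //.
  - by move=> t _; rewrite lee_fin; have /andP[] := phi01 t.
  - by apply/measurable_EFinP; exact: measurable_funTS.
  - by move=> t _; rewrite lee_fin; have /andP[] := phi01 t.
rewrite -[leRHS]mul1e -integral_cst//.
apply: ge0_le_integral => //.
- by move=> t _; rewrite lee_fin subr_ge0; have /andP[] := phi01 t.
- apply/measurable_EFinP; apply: measurable_funTS; apply: measurable_funB.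
    exact: measurable_cst.
  exact: mphi.
- by move=> t _; rewrite lee_fin gerBl; have /andP[] := phi01 t.
Qed.

End pairing.

Section cells.
Context {R : realType}.
Variables (P : nat -> R).
Hypothesis ndP : forall i, P i <= P i.+1.

Let leP i j : (i <= j)%N -> P i <= P j.
Proof. by move=> ij; exact: (nondecreasing_seqP P).1. Qed.

Lemma integral_cells (m : {measure set (measurableTypeR R) -> \bar R})
    (h : measurableTypeR R -> \bar R) n :
  measurable_fun setT h -> (forall t, 0 <= h t)%E ->
  (\sum_(i < n) \int[m]_(t in `]P i, P i.+1]) h t = \int[m]_(t in `]P 0, P n]) h t)%E.
Proof.
move=> mh h0; elim: n => [|n IH].
  by rewrite big_ord0 set_itvoc0 integral_set0.
rewrite big_ord_recr/= IH [in RHS](@itv_bndbnd_setU _ _ _ (BRight (P n))) ?bnd_simp ?leP//.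
rewrite ge0_integral_setU//.
- exact: measurable_funTS.
- apply/disj_setPS => t; rewrite /= !in_itv/= => -[/andP[_ tn] /andP[]].
  by rewrite ltNge tn.
Qed.

(** The cells are disjoint, so each breakpoint spoils at most one of them; the
bound does not depend on the number of cells. *)
Lemma sum_bad_cells (s : seq R) n :
  (\sum_(i < n) has (fun c => (P i < c <= P i.+1)%R) s <= size s)%N.
Proof.
have one c : (\sum_(i < n) ((P i < c <= P i.+1)%R : nat) = (P 0 < c <= P n)%R)%N.
  elim: n => [|n IH].
    by rewrite big_ord0; case: (ltP (P 0) c) => //= h; rewrite leNgt h.
  rewrite big_ord_recr/= IH.
  have [h1|h1] := ltP (P n) c => /=.
    rewrite andbF add0n.
    by rewrite (le_lt_trans (leP (leq0n n)) h1).
  by rewrite andbT addn0 (le_trans h1 (ndP n)) andbT.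
apply: (@leq_trans (\sum_(i < n) \sum_(c <- s) ((P i < c <= P i.+1)%R : nat))).
  apply: leq_sum => i _; elim: s => [|c s IH]; first by rewrite big_nil.
  by rewrite big_cons /=; case: (_ < _ <= _).
rewrite exchange_big/= -sum1_size; apply: leq_sum => c _.
by rewrite one; case: (_ < _ <= _).
Qed.

End cells.

Lemma lebesgue_measure_oc {R : realType} (a b : R) : a <= b ->
  lebesgue_measure (`]a, b]%classic : set (measurableTypeR R)) = (b - a)%:E.
Proof.
move=> ab; rewrite lebesgue_measure_itv/= lte_fin.
by case: ltgtP ab => // -> _; rewrite subrr.
Qed.

Lemma integral_unit_fin_num {R : realType} (h : measurableTypeR R -> R) :
  measurable_fun setT h -> (forall t, 0 <= h t <= 1) ->
  (\int[@lebesgue_measure R]_(t in `]0%R, 1%R]) (h t)%:E)%E \is a fin_num.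
Proof.
move=> mh h01; rewrite ge0_fin_numE; last first.
  by apply: integral_ge0 => t _; rewrite lee_fin; have /andP[] := h01 t.
apply: (@le_lt_trans _ _ (\int[lebesgue_measure]_(t in `]0%R, 1%R]) (cst 1 t))%E).
  apply: ge0_le_integral => //.
  - by move=> t _; rewrite lee_fin; have /andP[] := h01 t.
  - by apply/measurable_EFinP; exact: measurable_funTS.
  - by move=> t _; rewrite lee_fin; have /andP[] := h01 t.
by rewrite integral_cst// mul1e [X in (X < _)%E]lebesgue_measure_oc// ltry.
Qed.

Section cell_sums.
Context {R : realType}.
Let lam : {measure set (measurableTypeR R) -> \bar R} := @lebesgue_measure R.
Variables (eps : R) (nu : {measure set (measurableTypeR R) -> \bar R}).
Variables (w alpha h : measurableTypeR R -> R) (s : seq R) (delta : R).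
Hypotheses (eps0 : 0 < eps)
  (mw : measurable_fun setT w) (w01 : forall t, 0 <= w t <= 1)
  (mh : measurable_fun setT h) (h01 : forall t, 0 <= h t <= 1)
  (exch : forall C W, measurable C -> measurable W -> W `<=` C ->
     pairing eps nu w C W = (\int[lam]_(t in C) (h t)%:E)%E)
  (malpha : measurable_fun setT alpha) (alpha01 : forall t, 0 <= alpha t <= 1)
  (salpha : step_off s alpha)
  (err : (error eps nu alpha w `]0%R, 1%R] <= delta%:E)%E).
Variables (P : nat -> R) (n : nat) (y : R) (W : nat -> set (measurableTypeR R)).
Hypotheses (P0 : P 0 = 0) (ndP : forall i, P i <= P i.+1) (y0 : 0 <= y)
  (mW : forall i, measurable (W i)) (WP : forall i, W i `<=` `]P i, P i.+1]).

Let C i : set (measurableTypeR R) := `]P i, P i.+1].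
Let mC i : measurable (C i). Proof. exact: measurable_itv. Qed.
Let bad i := has (fun c => P i < c <= P i.+1) s.

Let c : R := fine (\int[lam]_(t in `]0%R, 1%R]) (h t)%:E).

Let cE : (\int[lam]_(t in `]0%R, 1%R]) (h t)%:E)%E = c%:E.
Proof.
by rewrite /c fineK// integral_unit_fin_num.
Qed.

Let alpha_cst i : ~~ bad i -> forall t, C i t -> alpha t = alpha (P i.+1).
Proof.
move=> /hasPn nb t; rewrite /C/= in_itv/= => /andP[t1 t2].
apply: salpha => // u us; apply: contra (nb u us) => /andP[tu ->].
by rewrite (lt_le_trans t1 tu).
Qed.

Let sum_int (m : {measure set (measurableTypeR R) -> \bar R}) (k : measurableTypeR R -> R) :
  measurable_fun setT k -> (forall t, 0 <= k t) ->
  (\sum_(i < n) \int[m]_(t in C i) (k t)%:E = \int[m]_(t in `]0%R, P n]) (k t)%:E)%E.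
Proof.
move=> mk k0; rewrite -P0.
by apply: (integral_cells ndP) => //; exact/measurable_EFinP.
Qed.

Let sum_error : P n <= 1 ->
  (\sum_(i < n) error eps nu alpha w (C i) <= delta%:E)%E.
Proof.
move=> Pn1; apply: le_trans err; rewrite /error big_split/=.
have md : measurable_fun setT (fun t => `|alpha t - w t| : R).
  by apply: measurableT_comp; [exact: normr_measurable|exact: measurable_funB].
rewrite -ge0_sume_distrr; last by move=> i _; exact: integral_ge0.
have sub : (`]0%R, P n] : set (measurableTypeR R)) `<=` `]0%R, 1%R].
  by apply: subset_itvl; rewrite bnd_simp.
rewrite !sum_int//; apply: leeD; last first.
  apply: ge0_subset_integral => //; exact/measurable_EFinP/measurable_funTS.
rewrite lee_pmul2l ?lte_fin//.
apply: ge0_subset_integral => //; exact/measurable_EFinP/measurable_funTS.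
Qed.

Let sum_bad (z : R) : 0 <= z ->
  (\sum_(i < n) (z * (bad i)%:R)%:E <= (z * (size s)%:R)%:E)%E.
Proof.
move=> z0; rewrite sumEFin lee_fin -mulr_sumr ler_wpM2l// -natr_sum ler_nat.
exact: sum_bad_cells.
Qed.

(** In a cell without breakpoints the step function is constant, and 2 y is at
most its pairing, which differs from the integral of [h] by the local error; in
each of the other cells 2 y is simply given away. *)
Lemma cell_sum_upper : P n <= 1 ->
  (forall i, (i < n)%N -> (2 * y)%:E <= eps%:E * nu (W i))%E ->
  (forall i, (i < n)%N -> (2 * y)%:E <= lam (C i `\` W i))%E ->
  2 * y * n%:R <= c + delta + 2 * y * (size s)%:R.
Proof.
move=> Pn1 nuW lamW.
have y2 : 0 <= 2 * y by rewrite mulr_ge0.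
have cell i : (i < n)%N -> ((2 * y)%:E <= \int[lam]_(t in C i) (h t)%:E +
    error eps nu alpha w (C i) + (2 * y * (bad i)%:R)%:E)%E.
  move=> ni; have [b|nb] := boolP (bad i).
    rewrite mulr1 leeDr// adde_ge0//.
      by apply: integral_ge0 => t _; rewrite lee_fin; have /andP[] := h01 t.
    by rewrite adde_ge0 ?mule_ge0 ?lee_fin ?(ltW eps0)//; exact: integral_ge0.
  rewrite mulr0 adde0 -(exch (mC i) (mW i) (@WP i)).
  apply: le_trans (pairing_le_error _ _ _ _ _ _ _ _ _) => //.
  rewrite (pairing_cst eps nu (mC i) (mW i) (@WP i) (alpha_cst nb)).
  have /andP[a0 a1] := alpha01 (P i.+1); set a := alpha _ in a0 a1 *.
  have -> : ((2 * y)%:E = a%:E * (2 * y)%:E + (1 - a)%:E * (2 * y)%:E)%E.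
    by rewrite -!EFinM -EFinD; congr EFin; ring.
  by apply: leeD; apply: lee_wpmul2l; rewrite ?lee_fin ?subr_ge0//; [exact: nuW|exact: lamW].
have : (\sum_(i < n) (2 * y)%:E <= \sum_(i < n) (\int[lam]_(t in C i) (h t)%:E +
    error eps nu alpha w (C i) + (2 * y * (bad i)%:R)%:E))%E.
  by apply: lee_sum => i _; exact: cell.
rewrite 2!big_split/= sumEFin sumr_const card_ord -[_ *+ n]mulr_natr => /le_trans H.
rewrite -lee_fin; apply: H; rewrite !EFinD; apply: leeD; last exact: sum_bad.
apply: leeD; last exact: sum_error.
rewrite sum_int//; last by move=> t; have /andP[] := h01 t.
rewrite -cE; apply: ge0_subset_integral => //.
- exact/measurable_EFinP/measurable_funTS.
- by move=> t _; rewrite lee_fin; have /andP[] := h01 t.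
- by apply: subset_itvl; rewrite bnd_simp.
Qed.

(** Here a cell containing breakpoints contributes at most 4 y, hence an excess of
2 y over the others. *)
Lemma cell_sum_lower : P n = 1 ->
  (forall i, (i < n)%N -> eps%:E * nu (W i) <= (2 * y)%:E)%E ->
  (forall i, (i < n)%N -> lam (C i `\` W i) <= (2 * y)%:E)%E ->
  c <= delta + 2 * y * (n%:R + (size s)%:R).
Proof.
move=> Pn1 nuW lamW.
have y2 : 0 <= 2 * y by rewrite mulr_ge0.
have cell i : (i < n)%N -> (\int[lam]_(t in C i) (h t)%:E <=
    error eps nu alpha w (C i) + (2 * y)%:E + (2 * y * (bad i)%:R)%:E)%E.
  move=> ni; rewrite -(exch (mC i) (mW i) (@WP i)).
  rewrite -addeA addeC error_sym.
  apply: le_trans (@pairing_le_error _ eps nu eps0 w alpha _ _ mw malpha w01 alpha01 (mC i) (mW i) (@WP i)) _.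
  rewrite leeD2r//.
  have [b|nb] := boolP (bad i).
    rewrite mulr1; apply: le_trans (pairing_le1 _ _ _ _ _ _) _ => //.
    by apply: leeD; [exact: nuW|exact: lamW].
  rewrite mulr0 adde0.
  rewrite (pairing_cst eps nu (mC i) (mW i) (@WP i) (alpha_cst nb)).
  have /andP[a0 a1] := alpha01 (P i.+1); set a := alpha _ in a0 a1 *.
  have -> : ((2 * y)%:E = a%:E * (2 * y)%:E + (1 - a)%:E * (2 * y)%:E)%E.
    by rewrite -!EFinM -EFinD; congr EFin; ring.
  by apply: leeD; apply: lee_wpmul2l; rewrite ?lee_fin ?subr_ge0//; [exact: nuW|exact: lamW].
have : (\sum_(i < n) \int[lam]_(t in C i) (h t)%:E <= \sum_(i < n) (
    error eps nu alpha w (C i) + (2 * y)%:E + (2 * y * (bad i)%:R)%:E))%E.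
  by apply: lee_sum => i _; exact: cell.
rewrite sum_int//; last by move=> t; have /andP[] := h01 t.
rewrite Pn1 cE 2!big_split/= [X in (_ + X + _)%E]sumEFin sumr_const card_ord -[_ *+ n]mulr_natr => H.
rewrite -lee_fin; apply: le_trans H _.
rewrite mulrDr addrA !EFinD; apply: leeD; last exact: sum_bad.
by apply: leeD => //; apply: sum_error; rewrite Pn1.
Qed.

End cell_sums.

(** * Quantiles *)

Section quantile.
Context {R : realType} (mu : probability (measurableTypeR R) R).

Let idTR : measurableTypeR R -> R := idfun.
#[local] HB.instance Definition _ :=
  @isMeasurableFun.Build _ _ _ _ idTR (@measurable_id _ _ setT).

Let dfunE : dfun mu = fun r => fine (cdf (idTR : {RV mu >-> R}) r).
Proof. by []. Qed.

Lemma dfun_nd a b : a <= b -> dfun mu a <= dfun mu b.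
Proof. by move=> ab; rewrite dfunE/= fine_le ?fin_num_measure//; exact: cdf_nondecreasing. Qed.

Lemma dfun_ge0 a : 0 <= dfun mu a. Proof. exact: fine_ge0. Qed.

Lemma dfun_left_le1 a : dfun_left mu a <= 1.
Proof.
rewrite /dfun_left -[leRHS]/(fine 1%E) fine_le ?fin_num_measure//.
exact: probability_le1.
Qed.

Lemma dfun_left_le a : dfun_left mu a <= dfun mu a.
Proof.
rewrite /dfun_left /dfun fine_le ?fin_num_measure//.
by apply: le_measure; rewrite ?inE//; apply: subset_itvl; rewrite bnd_simp.
Qed.

Lemma dfun_le_left a b : a < b -> dfun mu a <= dfun_left mu b.
Proof.
move=> ab; rewrite /dfun_left /dfun fine_le ?fin_num_measure//.
by apply: le_measure; rewrite ?inE//; apply: subset_itvl; rewrite bnd_simp.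
Qed.

Definition quantile (t : R) : R := fine (dfun_inv mu t).

(** F and its inverse form a Galois connection, up to the behaviour of F at the
quantile itself.  The tails of F make the supremum finite. *)
Lemma quantile_spec (t : R) : 0 < t -> t < 1 ->
  dfun_inv mu t = (quantile t)%:E /\
  forall z, (z < quantile t -> dfun mu z <= t) /\ (dfun mu z <= t -> z <= quantile t).
Proof.
move=> t0 t1; pose S := [set y : R | dfun mu y <= t].
have [a Sa] : exists a, S a.
  have /filter_ex[a /=] : \forall z \near -oo, dfun mu z <= t.
    have : dfun mu @ -oo --> (0:R) by rewrite dfunE; exact/fine_cvg/cvg_cdfNy0.
    by move/cvgr_le; apply.
  by exists a.
have [b Sb] : exists b, t < dfun mu b.
  have /filter_ex[b /=] : \forall z \near +oo, t < dfun mu z.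
    have : dfun mu @ +oo --> (1:R) by rewrite dfunE; exact/fine_cvg/cvg_cdfy1.
    by move/cvgr_gt; apply.
  by exists b.
have hS : has_sup S.
  split; [by exists a | exists b => z Sz; rewrite leNgt; apply/negP => /ltW/dfun_nd bz].
  by have := lt_le_trans Sb (le_trans bz Sz); rewrite ltxx.
have E : dfun_inv mu t = (sup S)%:E by rewrite /dfun_inv ereal_sup_EFin//; case: hS.
rewrite /quantile E; split => // z; split => [/(sup_gt hS.1) [y Sy zy]|Sz].
  exact: le_trans (dfun_nd (ltW zy)) Sy.
by apply: ub_le_sup Sz; case: hS.
Qed.

(** By right continuity of F: all points to the right of the quantile have a
value above [t]. *)
Lemma dfun_quantile (t : R) : 0 < t -> t < 1 -> t <= dfun mu (quantile t).
Proof.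
move=> t0 t1; have [_ H] := quantile_spec t0 t1.
have rc : dfun mu @ (quantile t)^'+ --> dfun mu (quantile t).
  rewrite dfunE; apply: fine_cvg; rewrite fineK ?fin_num_measure//.
  exact: cdf_right_continuous.
apply: (cvgr_to_ge rc).
near=> z; rewrite leNgt; apply/negP => /ltW /(H z).2.
by rewrite leNgt; apply/negP/negPn; near: z; exact: nbhs_right_gt.
Unshelve. all: end_near. Qed.

Lemma quantile_nd (a b : R) : 0 < a -> a <= b -> b < 1 -> quantile a <= quantile b.
Proof.
move=> a0 ab b1.
have [ea _] := quantile_spec a0 (le_lt_trans ab b1).
have [eb _] := quantile_spec (lt_le_trans a0 ab) b1.
rewrite -lee_fin -ea -eb; apply: ereal_sup_le => _ [z za <-].
by exists z => //=; exact: le_trans za ab.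
Qed.

End quantile.

(** * Finitely supported measures and the Levy distance *)

Section finite_support.
Context {R : realType}.

Lemma dfun_delta n (x p : 'rV[R]_n) (z : R) :
  dfun (delta x p) z = \sum_(j < n | x 0 j <= z) p 0 j.
Proof.
rewrite /dfun /delta.
under eq_bigr do rewrite diracE -EFinM.
rewrite sumEFin/= [RHS]big_mkcond; apply: eq_bigr => j _.
case: ifPn => h; first by rewrite mem_set ?mulr1//= in_itv.
by rewrite memNset ?mulr0//= in_itv/=; exact/negP.
Qed.

Definition psum n (p : 'rV[R]_n) (i : nat) : R := \sum_(j < n | (j < i)%N) p 0 j.

Lemma psum0 n (p : 'rV[R]_n) : psum p 0 = 0.
Proof. by rewrite /psum big_pred0. Qed.

Lemma psum_full n (p : 'rV[R]_n) : Pi p -> psum p n = 1.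
Proof. by move=> [_ <-]; apply: eq_bigl => j; rewrite ltn_ord. Qed.

Let sum_sub n (p : 'rV[R]_n) (A B : pred 'I_n) : Pi p ->
  (forall j, A j -> B j) -> \sum_(j < n | A j) p 0 j <= \sum_(j < n | B j) p 0 j.
Proof.
move=> [p0 _] AB; rewrite big_mkcond [leRHS]big_mkcond/=; apply: ler_sum => j _.
by case: ifPn => [/AB ->//|_]; case: ifPn.
Qed.

Lemma psum_nd n (p : 'rV[R]_n) i : Pi p -> psum p i <= psum p i.+1.
Proof. by move=> Pp; apply: sum_sub => // j /ltnW. Qed.

Lemma psum_ge0 n (p : 'rV[R]_n) i : Pi p -> 0 <= psum p i.
Proof. by move=> [p0 _]; exact: sumr_ge0. Qed.

Lemma psum_le1 n (p : 'rV[R]_n) i : Pi p -> psum p i <= 1.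
Proof.
by move=> Pp; have [_ <-] := Pp; apply: (@sum_sub _ _ _ xpredT).
Qed.

Lemma dfun_delta_lt n (x p : 'rV[R]_n) (i : 'I_n) z : Xi x -> Pi p ->
  z < x 0 i -> dfun (delta x p) z <= psum p i.
Proof.
move=> Xx Pp zx; rewrite dfun_delta; apply: sum_sub => // j jz.
by rewrite ltnNge; apply/negP => /Xx; rewrite leNgt (le_lt_trans jz zx).
Qed.

Lemma dfun_delta_ge n (x p : 'rV[R]_n) (i : 'I_n) : Xi x -> Pi p ->
  psum p i.+1 <= dfun (delta x p) (x 0 i).
Proof. by move=> Xx Pp; rewrite dfun_delta; apply: sum_sub => // j /Xx. Qed.

Lemma dfun_delta01 n (x p : 'rV[R]_n) z : Pi p -> 0 <= dfun (delta x p) z <= 1.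
Proof.
move=> Pp; rewrite dfun_delta; apply/andP; split.
  by case: Pp => p0 _; exact: sumr_ge0.
by have [_ <-] := Pp; apply: (@sum_sub _ _ _ xpredT).
Qed.

(** Every value of the distribution function of a finitely supported measure is
one of its levels [P k], attained between the atoms [k - 1] and [k]. *)
Lemma dfun_delta_steps (P X : nat -> R) n z : (forall i, X i <= X i.+1) ->
  exists k, [/\ (k <= n)%N, ((k < n)%N -> z < X k), ((0 < k)%N -> X k.-1 <= z) &
    dfun (delta (\row_(i < n) X i) (\row_(i < n) (P i.+1 - P i))) z = P k - P 0].
Proof.
move=> ndX.
have leX i j : (i <= j)%N -> X i <= X j.
  by move=> ij; exact: (nondecreasing_seqP X).1.
rewrite dfun_delta.
have -> : \sum_(j < n | (\row_(i < n) X i) 0 j <= z) (\row_(i < n) (P i.+1 - P i)) 0 j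
    = \sum_(j < n | X j <= z) (P j.+1 - P j).
  by apply: eq_big => [j|j _]; rewrite mxE.
elim: n => [|n [k [kn zk kz E]]].
  by exists 0%N; split => //; rewrite big_ord0 subrr.
rewrite big_mkcond big_ord_recr -big_mkcond/= E.
have [Xz|zX] := leP (X n) z.
- have kn' : k = n.
    apply/eqP; rewrite eqn_leq kn leqNgt; apply/negP => kn'.
    by have := lt_le_trans (zk kn') (le_trans (leX _ _ kn) Xz); rewrite ltxx.
  exists n.+1; split; rewrite ?ltnn// kn'; ring.
- exists k; split; rewrite ?addr0//; first exact: leqW.
  rewrite ltnS leq_eqVlt => /orP[/eqP ->//|]; exact: zk.
Qed.

End finite_support.

Section feasible.
Context {R : realType} (mu : probability (measurableTypeR R) R) (eps : R).
Hypothesis eps0 : 0 < eps.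

Definition levy_feasible (nu : set (measurableTypeR R) -> \bar R) (y : R) : Prop :=
  0 < y /\ forall x : R,
    dfun_left mu (x - y / eps) - y <= dfun nu x /\
    dfun nu x <= dfun mu (x + y / eps) + y.

Lemma levy_dist_le nu y : levy_feasible nu y -> levy_dist eps mu nu <= y.
Proof.
by move=> h; apply: ge_inf => //; exists 0 => z [/ltW].
Qed.

(** The infimum defining the distance is taken over a nonempty set, since y = 1
is always admissible. *)
Lemma levy_dist_lt n (x p : 'rV[R]_n) y : Pi p ->
  levy_dist eps mu (delta x p) < y ->
  exists2 y', levy_feasible (delta x p) y' & y' < y.
Proof.
move=> Pp; apply: inf_lt; exists 1; split=> // z.
have /andP[d0 d1] := dfun_delta01 x z Pp; split.
  by rewrite (le_trans _ d0)// subr_le0 dfun_left_le1.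
by rewrite (le_trans d1)// lerDr dfun_ge0.
Qed.

(** Just left of the atom [i] the approximating distribution function is at most
[psum p i], so F is at most [psum p i + y] left of [x_i - y / eps]; at the atom
it is at least [psum p i.+1], so F is at least [psum p i.+1 - y] at
[x_i + y / eps].  Between these two levels the quantile is trapped. *)
Lemma feasible_quantile n (x p : 'rV[R]_n) (i : 'I_n) y t :
  Xi x -> Pi p -> levy_feasible (delta x p) y ->
  psum p i + y <= t -> t < psum p i.+1 - y ->
  x 0 i - y / eps <= quantile mu t <= x 0 i + y / eps.
Proof.
move=> Xx Pp [y0 H] t1 t2.
have t0 : 0 < t by rewrite (lt_le_trans _ t1)// ltr_wpDl// psum_ge0.
have t1' : t < 1.
  by rewrite (lt_le_trans t2)// lerBlDr (le_trans (psum_le1 _ Pp))// lerDl ltW.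
have [_ Q] := quantile_spec mu t0 t1'.
apply/andP; split.
  apply/ler_addgt0Pl => d d0; rewrite -lerBlDl.
  apply: (Q _).2; pose z := x 0 i - d / 2.
  have [Hz _] := H z.
  apply: (@le_trans _ _ (dfun_left mu (z - y / eps))).
    by apply: dfun_le_left; rewrite /z; lra.
  apply: le_trans t1; rewrite -lerBlDr; apply: le_trans Hz _.
  by apply: dfun_delta_lt => //; rewrite /z; lra.
have [_ Hx] := H (x 0 i).
rewrite leNgt; apply/negP => /(Q _).1; rewrite leNgt => /negP; apply.
apply: (lt_le_trans t2); rewrite lerBlDr; apply: le_trans Hx.
exact: dfun_delta_ge.
Qed.

End feasible.

(** * Greedy construction of the levels *)

Section greedy.
Context {R : realType} (mu : probability (measurableTypeR R) R) (eps : R).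
Hypothesis eps0 : 0 < eps.
Variable y : R.
Hypotheses (y0 : 0 < y) (y1 : y < 1).

(** Truncating at [1 - y] keeps the level inside ]0, 1[, where the quantile is
finite; as soon as the truncation is active, the next level is 1. *)
Definition greedy_level (v : R) : R := Num.min (v + y) (1 - y).

(** From the level [v], go up by y, move right by the full width 2 y / eps allowed
to an atom, read off F there, and go up by y again. *)
Definition greedy_step (v : R) : R :=
  Num.min 1 (dfun mu (quantile mu (greedy_level v) + 2 * y / eps) + y).

Definition greedy (n : nat) : R := iter n greedy_step 0.

Let ye0 : 0 <= 2 * y / eps.
Proof. by rewrite divr_ge0 ?(ltW eps0)// mulr_ge0// ltW. Qed.

Let level_bound v : 0 <= v -> 0 < greedy_level v < 1.
Proof.
move=> v0; rewrite lt_min gt_min subr_gt0 y1 andbT ltr_wpDl//=.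
by rewrite ltrBlDr ltrDl y0 orbT.
Qed.

Let level_le v : 0 <= v ->
  greedy_level v <= dfun mu (quantile mu (greedy_level v) + 2 * y / eps).
Proof.
move=> /level_bound /andP[l0 l1].
by rewrite (le_trans (dfun_quantile mu l0 l1))// dfun_nd// lerDl.
Qed.

Let step_ge v : 0 <= v <= 1 -> v <= greedy_step v.
Proof.
move=> /andP[v0 v1]; rewrite le_min v1/=.
apply: le_trans (_ : greedy_level v + y <= _); last by rewrite lerD2r level_le.
by rewrite -lerBlDr le_min; move: y0 v1 => Y V; apply/andP; split; lra.
Qed.

Lemma greedy01 n : 0 <= greedy n <= 1.
Proof.
elim: n => [|n IH]; first by rewrite lexx ler01.
rewrite /= ge_min lexx/= andbT.
by have /andP[h _] := IH; exact: le_trans h (step_ge IH).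
Qed.

Lemma greedy_nd n : greedy n <= greedy n.+1.
Proof. exact: step_ge (greedy01 n). Qed.

Let greedy_homo i j : (i <= j)%N -> greedy i <= greedy j.
Proof.
by move=> ij; exact: (nondecreasing_seqP greedy).1 greedy_nd i j ij.
Qed.

(** The centre of the window of width 2 y / eps that a greedy step crosses. *)
Definition greedy_atom (n : nat) : R :=
  quantile mu (greedy_level (greedy n)) + y / eps.

Lemma greedy_atom_nd n : greedy_atom n <= greedy_atom n.+1.
Proof.
rewrite lerD2r; apply: quantile_nd.
- by have /andP[/level_bound/andP[]] := greedy01 n.
- by rewrite le_min !ge_min lerD2r greedy_nd lexx !orbT.
- by have /andP[/level_bound/andP[]] := greedy01 n.+1.
Qed.

Lemma greedy_feasible n : greedy n = 1 ->
  exists x p : 'rV[R]_n, [/\ Xi x, Pi p & levy_feasible mu eps (delta x p) y].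
Proof.
move=> gn; exists (\row_(i < n) greedy_atom i), (\row_(i < n) (greedy i.+1 - greedy i)).
split.
- move=> i j ij; rewrite !mxE.
  exact: (nondecreasing_seqP greedy_atom).1 greedy_atom_nd i j ij.
- split; first by move=> j; rewrite mxE subr_ge0 greedy_nd.
  under eq_bigr do rewrite mxE.
  by rewrite -(big_mkord xpredT (fun i => greedy i.+1 - greedy i)) telescope_sumr// gn subr0.
split => // z.
have [k [kn zk kz ->]] := dfun_delta_steps greedy n z greedy_atom_nd.
rewrite [greedy 0]/= subr0; split.
- move: kn; rewrite leq_eqVlt => /orP[/eqP ->|/zk zk'].
    by rewrite gn lerBlDr (le_trans (dfun_left_le1 _ _))// lerDl ltW.
  have /andP[g0 _] := greedy01 k.
  have /andP[l0 l1] := level_bound g0.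
  have [_ Q] := quantile_spec mu l0 l1.
  rewrite lerBlDr; apply: le_trans (dfun_left_le _ _) _.
  have /(Q _).1 /le_trans : z - y / eps < quantile mu (greedy_level (greedy k)).
    by rewrite ltrBlDr.
  by apply; rewrite ge_min lexx.
- case: k kz {kn zk} => [_|k /(_ isT) /= kz].
    by rewrite [greedy 0]/= addr_ge0 ?dfun_ge0// ltW.
  rewrite ge_min; apply/orP; right; rewrite lerD2r; apply: dfun_nd.
  rewrite (_ : 2 * y / eps = y / eps + y / eps); last by ring.
  by rewrite addrA lerD2r.
Qed.

(** As long as the level 1 has not been reached, no truncation took place: the
quantile really crosses the full width 2 y / eps between the two levels. *)
Lemma greedy_saturated n i : greedy n < 1 -> (i < n)%N ->
  let a := greedy i + y in let b := greedy i.+1 - y in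
  [/\ 0 < a, a <= b, b < 1 & 2 * y / eps <= quantile mu b - quantile mu a].
Proof.
move=> gn1 ni a b.
have g1 : greedy i.+1 < 1 by exact: le_lt_trans (greedy_homo ni) gn1.
have /andP[g0 _] := greedy01 i.
have lle := level_le g0.
have gE : greedy i.+1 =
    dfun mu (quantile mu (greedy_level (greedy i)) + 2 * y / eps) + y.
  by move: g1; rewrite [greedy i.+1]/= /greedy_step gt_min ltxx/= => h; rewrite min_r// ltW.
have lE : greedy_level (greedy i) = a.
  rewrite /greedy_level min_l// leNgt; apply/negP => h.
  move: g1; rewrite gE ltNge => /negP; apply.
  by rewrite -lerBlDr (le_trans _ lle)// /greedy_level min_r// ltW.
have a0 : 0 < a by rewrite ltr_wpDl.
rewrite lE in gE lle.
have bE : b = dfun mu (quantile mu a + 2 * y / eps) by rewrite /b gE addrK.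
have ab : a <= b by rewrite bE.
have b1 : b < 1 by rewrite /b ltrBlDr (lt_le_trans g1)// lerDl ltW.
split => //; rewrite lerBrDl.
have [_ Q] := quantile_spec mu (lt_le_trans a0 ab) b1.
by apply: (Q _).2; rewrite bE.
Qed.

End greedy.

(** * The rate of best approximation *)

(** A null set carrying the singular part may be enlarged by the point 1, which
makes the weight vanish there. *)
Lemma singular_carrier {R : realType}
    (nuS : {measure set (measurableTypeR R) -> \bar R}) :
  mutually_singular nuS (@lebesgue_measure R) ->
  exists N : set (measurableTypeR R),
    [/\ measurable N, @lebesgue_measure R N = 0%E, nuS (~` N) = 0%E & N 1].
Proof.
move=> [N [mN N0 NC]].
have m1 : measurable ([set 1] : set (measurableTypeR R)) by exact: measurable_set1.
exists (N `|` [set 1]); split.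
- exact: measurableU.
- rewrite measureU0//; exact: lebesgue_measure_set1.
- apply/eqP; rewrite eq_le measure_ge0 andbT -NC; apply: le_measure; rewrite ?inE.
  + by apply: measurableC; exact: measurableU.
  + exact: measurableC.
  + by apply: subsetC; exact: subsetUl.
- by right.
Qed.

Section rate.
Context {R : realType}.
Let lam : {measure set (measurableTypeR R) -> \bar R} := @lebesgue_measure R.
Variables (mu : probability (measurableTypeR R) R) (eps : R).
Variables (nu nuA nuS : {measure set (measurableTypeR R) -> \bar R}).
Variables (f : measurableTypeR R -> R) (N : set (measurableTypeR R)).
Hypotheses (eps0 : 0 < eps)
  (nuC : nu (~` `]0%R, 1%R[%classic) = 0%E)
  (nuI : forall a b : R, 0 < a -> a <= b -> b < 1 ->
    nu `]a, b]%classic = (quantile mu b - quantile mu a)%:E)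
  (nuAS : forall A, measurable A -> nu A = (nuA A + nuS A)%E)
  (nuAf : is_density lam nuA f)
  (mN : measurable N) (N0 : lam N = 0%E) (NC : nuS (~` N) = 0%E) (N1 : N 1).

Let r : measurableTypeR R -> R := resolvent eps f.
Let h (t : measurableTypeR R) : R := 1 - r t.
Let c : R := fine (\int[lam]_(t in `]0%R, 1%R]) (h t)%:E).

Let mh : measurable_fun setT h.
Proof.
apply: measurable_funB; first exact: measurable_cst.
exact: measurable_resolvent nuAf.
Qed.

Let h01 t : 0 <= h t <= 1.
Proof.
have /andP[r0 r1] := resolvent01 eps0 nuAf t.
by rewrite subr_ge0 r1 gerBl.
Qed.

Let w : measurableTypeR R -> R := weight eps f N.

Let mw : measurable_fun setT w.
Proof. exact: measurable_weight nuAf mN. Qed.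

Let w01 t : 0 <= w t <= 1.
Proof. exact: weight01 eps0 nuAf t. Qed.

Let exch C W : measurable C -> measurable W -> W `<=` C ->
  pairing eps nu w C W = (\int[lam]_(t in C) (h t)%:E)%E.
Proof.
move=> mC mW WC.
exact: (weight_exchange eps0 nuAS nuAf mN N0 NC mC mW WC).
Qed.

Let approx (d : R) : 0 < d ->
  exists (alpha : measurableTypeR R -> R) s,
    [/\ measurable_fun setT alpha, step_off s alpha,
        forall t, 0 <= alpha t <= 1 &
        (error eps nu alpha w `]0%R, 1%R] <= d%:E)%E].
Proof.
move=> d0.
pose m : {measure set (measurableTypeR R) -> \bar R} := measure_add lam nu.
have e1 : 0 < 1 + eps by rewrite addr_gt0.
have lam1 : (lam `]0%R, 1%R]%classic < +oo)%E.
  by rewrite [X in (X < _)%E]lebesgue_measure_oc// ltry.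
have mI : measurable (`]0%R, 1%R]%classic : set (measurableTypeR R)) by exact: measurable_itv.
have [||||||alpha [s [malpha salpha alpha01 H]]] :=
    @step_fun_approx_unit _ m w (d / (1 + eps)).
- move=> a b a0 ab b1; rewrite [X in (X < _)%E](measure_addE lam nu) nuI//.
  by rewrite lte_add_pinfty ?ltry// [X in (X < _)%E]lebesgue_measure_oc// ltry.
- exact: mw.
- exact: w01.
- by rewrite /w /weight indicE memNset ?mulr0//= => /(_ N1).
- rewrite ge0_integral_measure_add//; last 2 first.
  + by move=> t _; rewrite lee_fin; have /andP[] := w01 t.
  + by apply/measurable_EFinP; exact: measurable_funTS.
  rewrite lte_add_pinfty//; last exact: (weight_finite eps0 nuAS nuAf).
  apply: le_lt_trans lam1; rewrite -[leRHS]mul1e -integral_cst//.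
  apply: ge0_le_integral => //.
  + by move=> t _; rewrite lee_fin; have /andP[] := w01 t.
  + by apply/measurable_EFinP; exact: measurable_funTS.
  + by move=> t _; rewrite lee_fin; have /andP[] := w01 t.
- by rewrite divr_gt0.
exists alpha, s; split => //.
move: H; rewrite ge0_integral_measure_add//; last first.
  apply/measurable_EFinP; apply: measurable_funTS.
  by apply: measurableT_comp; [exact: normr_measurable|exact: measurable_funB].
rewrite /error -/lam.
set a := (\int[lam]_(t in _) _)%E; set b := (\int[nu]_(t in _) _)%E => H.
have a0 : (0 <= a)%E by exact: integral_ge0.
have b0 : (0 <= b)%E by exact: integral_ge0.
apply: (@le_trans _ _ ((1 + eps)%:E * (a + b))%E).
  rewrite [leRHS]ge0_muleDr// [leRHS]addeC; apply: leeD.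
    by rewrite lee_wpmul2r// lee_fin lerDr.
  by rewrite -[leLHS]mul1e lee_wpmul2r// lee_fin lerDl ltW.
apply: (@le_trans _ _ ((1 + eps)%:E * (d / (1 + eps))%:E)%E).
  by rewrite lee_wpmul2l ?lee_fin ?(ltW e1)// ltW.
by rewrite -EFinM lee_fin mulrC divfK// gt_eqF.
Qed.

Let lamB (C W : set (measurableTypeR R)) : measurable C -> measurable W -> W `<=` C ->
  (lam C < +oo)%E -> lam (C `\` W) = (lam C - lam W)%E.
Proof. by move=> mC mW WC Coo; rewrite measureD// setIidr. Qed.

Let nu_le (a b y : R) : 0 < a -> b < 1 -> 0 <= y ->
  (a <= b -> quantile mu b - quantile mu a <= 2 * y / eps) ->
  (eps%:E * nu `]a, b]%classic <= (2 * y)%:E)%E.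
Proof.
move=> a0 b1 y0 q; have [ab|ba] := leP a b.
  rewrite nuI// -EFinM lee_fin mulrC -ler_pdivlMr//; exact: q.
by rewrite set_itv_ge ?measure0 ?mule0 ?lee_fin ?mulr_ge0// bnd_simp -leNgt ltW.
Qed.

Let core_sub (a b y : R) : 0 <= y -> (`](a + y), (b - y)]%classic : set R) `<=` `]a, b]%classic.
Proof. by move=> y0; apply: subset_itv; rewrite bnd_simp ?lerDl// gerBl. Qed.

Let lam_core (a b y : R) : 0 <= y -> a + y <= b - y ->
  lam (`]a, b]%classic `\` `](a + y), (b - y)]%classic) = (2 * y)%:E.
Proof.
move=> y0 aby; have ab : a <= b by lra.
rewrite lamB; last 4 first.
- exact: measurable_itv.
- exact: measurable_itv.
- exact: core_sub.
- by rewrite [X in (X < _)%E]lebesgue_measure_oc// ltry.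
rewrite [X in (X - _)%E]lebesgue_measure_oc// [X in (_ - X)%E]lebesgue_measure_oc//.
by rewrite -EFinB; congr EFin; ring.
Qed.

Let lam_core_le (a b y : R) : 0 <= y -> a <= b ->
  (lam (`]a, b]%classic `\` `](a + y)%R, (b - y)%R]%classic) <= (2 * y)%:E)%E.
Proof.
move=> y0 ab; have [aby|aby] := leP (a + y) (b - y); first by rewrite lam_core.
rewrite [X in _ `\` X]set_itv_ge ?setD0; last by rewrite bnd_simp -leNgt ltW.
by rewrite [X in (X <= _)%E]lebesgue_measure_oc// lee_fin; lra.
Qed.

(** Enlarging an admissible [z] to [y] puts the core, including its right end,
inside the range of levels where [feasible_quantile] applies; no limit at the
ends of the core has to be taken. *)
Lemma levy_dist_lower (e : R) : 0 < e -> exists K : nat,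
  forall n (x p : 'rV[R]_n), Xi x -> Pi p ->
    c - e <= 2 * (n%:R + K%:R) * levy_dist eps mu (delta x p).
Proof.
move=> e0; have [alpha [s [malpha salpha alpha01 err]]] := approx e0.
exists (size s) => n x p Xx Pp; set d := levy_dist _ _ _.
have nK : 0 <= 2 * (n%:R + (size s)%:R) :> R by rewrite mulr_ge0 ?addr_ge0.
suff H y : d < y -> c - e <= 2 * (n%:R + (size s)%:R) * y.
  apply/ler_addgt0Pr => u u0.
  have k0 : 0 < 2 * (n%:R + (size s)%:R) + 1 :> R by rewrite ltr_wpDl.
  apply: le_trans (H (d + u / (2 * (n%:R + (size s)%:R) + 1)) _) _.
    by rewrite ltrDl divr_gt0.
  rewrite mulrDr lerD2l mulrA ler_pdivrMr// mulrC ler_pM2l// lerDl//.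
move=> /(levy_dist_lt Pp)[z zf zy].
have z0 : 0 < z by case: zf.
have y0 : 0 <= y by rewrite ltW// (lt_trans z0).
pose P := psum p; pose W i : set (measurableTypeR R) := `](P i + y), (P i.+1 - y)]%classic.
have ndP i : P i <= P i.+1 by exact: psum_nd.
have mW i : measurable (W i) by exact: measurable_itv.
have WP i : W i `<=` `]P i, P i.+1]%classic by exact: core_sub.
have := cell_sum_lower eps0 mw w01 mh h01 exch malpha alpha01 salpha err
  (psum0 p) ndP y0 mW WP (psum_full Pp).
rewrite -/c lerBlDl mulrAC; apply.
- move=> i ni; have yy : 0 < y by exact: lt_trans zy.
  apply: nu_le => //.
  + by rewrite ltr_wpDl// psum_ge0.
  + by rewrite ltrBlDr (le_lt_trans (psum_le1 _ Pp))// ltrDl.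
  + move=> ab.
    have q t : P i + y <= t -> t <= P i.+1 - y ->
        x 0 (Ordinal ni) - z / eps <= quantile mu t <= x 0 (Ordinal ni) + z / eps.
      move=> t1 t2; apply: feasible_quantile zf _ _ => //=.
        by rewrite (le_trans _ t1)// lerD2l ltW.
      by rewrite (le_lt_trans t2)// ltrD2l ltrN2.
    have /andP[q1 _] := q _ (lexx _) ab.
    have /andP[_ q2] := q _ ab (lexx _).
    have : z / eps <= y / eps by rewrite ler_pM2r ?invr_gt0// ltW.
    lra.
- by move=> i ni; exact: lam_core_le.
Qed.

(** If the greedy levels stay below 1 after [n] steps, all [n] cells are saturated
and 2 y n is bounded by c up to the error. *)
Lemma levy_feasible_upper (e : R) : 0 < e -> exists K : nat,
  forall n (y : R), 0 < y -> y < 1 -> c + e + 2 * y * K%:R < 2 * y * n%:R ->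
    exists x p : 'rV[R]_n, [/\ Xi x, Pi p & levy_feasible mu eps (delta x p) y].
Proof.
move=> e0; have [alpha [s [malpha salpha alpha01 err]]] := approx e0.
exists (size s) => n y y0 y1 big; apply: (greedy_feasible eps0 y0 y1).
have /andP[_ P1] := greedy01 mu eps0 y0 y1 n.
move: P1; rewrite le_eqVlt => /orP[/eqP//|P1].
pose P := greedy mu eps y; pose W i : set (measurableTypeR R) := `](P i + y), (P i.+1 - y)]%classic.
have ndP i : P i <= P i.+1 by exact: greedy_nd.
have mW i : measurable (W i) by exact: measurable_itv.
have WP i : W i `<=` `]P i, P i.+1]%classic by apply: core_sub; exact: ltW.
move: big; rewrite ltNge => /negP; case.
apply: (cell_sum_upper eps0 mw w01 mh h01 exch malpha alpha01 salpha err
  _ ndP (ltW y0) mW WP (ltW P1)) => // i ni.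
- have [a0 ab b1 q] := greedy_saturated eps0 y0 y1 P1 ni.
  rewrite /W nuI// -EFinM lee_fin [leRHS]mulrC.
  by rewrite -ler_pdivrMr.
- have [a0 ab b1 q] := greedy_saturated eps0 y0 y1 P1 ni.
  by rewrite lam_core// ltW.
Qed.

(** The inverse measure does not charge the complement of ]0, 1], and the exchange
identity with [W] equal to that complement turns this into the vanishing of the
integral of [h] there. *)
Lemma integral_Omega :
  (\int[lam]_t (Omega (eps * f t))%:E)%E = (c / 2)%:E.
Proof.
have mD : measurable (`]0%R, 1%R]%classic : set (measurableTypeR R)) by exact: measurable_itv.
have mDC : measurable (~` `]0%R, 1%R]%classic : set (measurableTypeR R)) by exact: measurableC.
have hE t : (Omega (eps * f t))%:E = ((2^-1)%:E * (h t)%:E)%E.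
  have g0 : 0 <= eps * f t by rewrite mulr_ge0 ?(ltW eps0)//; case: nuAf.
  rewrite -EFinM /Omega ger0_norm// /h /r /resolvent; congr EFin.
  have h1 : 1 + eps * f t != 0 by rewrite gt_eqF// ltr_pwDl.
  by field; rewrite h1 -[X in X + _]mulr1 -mulrDr mulf_neq0.
under eq_integral do rewrite hE.
rewrite ge0_integralZl_EFin//; last 2 first.
- by move=> t _; rewrite lee_fin; have /andP[] := h01 t.
- by apply/measurable_EFinP; exact: mh.
rewrite mulrC EFinM; congr (_ * _)%E.
rewrite -(setvU `]0%R, 1%R]%classic) ge0_integral_setU//; last 3 first.
- by apply/measurable_EFinP; exact: measurable_funTS.
- by move=> t _; rewrite lee_fin; have /andP[] := h01 t.
- by apply/disj_setPS => t [].
rewrite (_ : \int[lam]_(t in ~` _) _ = 0)%E ?add0e.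
  by rewrite /c fineK// integral_unit_fin_num.
have nu0 : nu (~` `]0%R, 1%R]%classic) = 0%E.
  apply/eqP; rewrite eq_le measure_ge0 andbT -nuC; apply: le_measure; rewrite ?inE//.
    by apply: measurableC; exact: measurable_itv.
  by apply: subsetC => t; rewrite /= !in_itv/= => /andP[-> /ltW].
rewrite -(exch mDC mDC (@subset_refl _ _)) /pairing setDv integral_set0 adde0.
rewrite null_set_integral ?mule0//.
by apply/measurable_EFinP; exact: measurable_funTS.
Qed.

Variables (x p : forall n : nat, 'rV[R]_n).
Hypothesis best : forall n, (0 < n)%N -> best_approx eps mu (x n) (p n).

(** The upper bound is applied to the [y] that solves 2 y (n - K2) = c + 2 e; it
makes the distance O(1/n), so that the terms K1 d_n and K2 d_n are negligible. *)
Lemma best_approx_rate :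
  n%:R * levy_dist eps mu (delta (x n) (p n)) @[n --> \oo] --> c / 2.
Proof.
set d := fun n => levy_dist eps mu (delta (x n) (p n)).
have c0 : 0 <= c.
  by rewrite fine_ge0// integral_ge0// => t _; rewrite lee_fin; have /andP[] := h01 t.
apply/cvgrPdist_le => e2 e20.
pose e := e2 / 2; have e0 : 0 < e by rewrite divr_gt0.
have [K1 low] := levy_dist_lower e0.
have [K2 up] := levy_feasible_upper e0.
pose k : R := c + e + e.
have k0 : 0 < k by rewrite /k; lra.
(* n - K2 >= M forces both y < 1 and (K1 + K2) d_n <= e *)
pose M : R := k + (K1%:R + K2%:R) * k / e + 1.
near=> n.
have nM : M <= n%:R - K2%:R by rewrite lerBrDr; near: n; exact: nbhs_infty_ger.
have kM : k < M.
  by rewrite /M -addrA ltrDl ltr_wpDl// divr_ge0 ?(ltW e0)// mulr_ge0 ?addr_ge0// ltW.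
have nK : 0 < n%:R - K2%:R :> R by rewrite (lt_le_trans _ nM)// (lt_trans k0).
have n0 : (0 < n)%N.
  by rewrite -(ltr_nat R) (lt_le_trans nK)// gerBl.
have dn0 : 0 <= d n.
  have [_ Pp _] := best n0; rewrite leNgt; apply/negP => /(levy_dist_lt Pp)[y [y0 _]].
  by rewrite ltNge ltW.
set D := n%:R - K2%:R in nM nK.
have dnD : 2 * D * d n <= k.
  have D2 : 0 < 2 * D by rewrite mulr_gt0.
  rewrite mulrC -ler_pdivlMr//.
  set y := k / _.
  have y0 : 0 < y by rewrite divr_gt0.
  have y1 : y < 1 by rewrite ltr_pdivrMr// mul1r; lra.
  have yE : 2 * y * n%:R = k + 2 * y * K2%:R.
    have -> : n%:R = D + K2%:R :> R by rewrite /D subrK.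
    by rewrite /y; field; rewrite gt_eqF.
  have [|x' [p' [Xx' Pp' ]]] := up n y y0 y1.
    by rewrite yE ltrD2r /k ltrDl.
  move=> /levy_dist_le; apply: le_trans.
  by have [_ _] := best n0; exact.
have small : (K1%:R + K2%:R) * d n <= e.
  have : (K1%:R + K2%:R) * k / e <= D by rewrite (le_trans _ nM)// /M; lra.
  rewrite ler_pdivrMr// => h1.
  have h2 : (K1%:R + K2%:R) * (D * d n) <= (K1%:R + K2%:R) * k.
    rewrite ler_wpM2l ?addr_ge0//; apply: le_trans dnD.
    by rewrite -mulrA ler_peMl ?ler1n// mulr_ge0// ltW.
  rewrite -(ler_pM2l nK); apply: le_trans h1; apply: le_trans h2.
  by rewrite mulrCA.
have K1d : 0 <= K1%:R * d n by rewrite mulr_ge0.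
have K2d : 0 <= K2%:R * d n by rewrite mulr_ge0.
have := low n (x n) (p n); have [Xx Pp _] := best n0 => /(_ Xx Pp); rewrite -/(d n) => lo.
have h1 : 2 * (n%:R * d n) - 2 * (K2%:R * d n) <= k.
  by apply: le_trans dnD; rewrite /D mulrBr mulrBl !mulrA.
have h2 : c - e <= 2 * (n%:R * d n) + 2 * (K1%:R * d n).
  by apply: le_trans lo _; rewrite mulrDr mulrDl !mulrA.
have h3 : K1%:R * d n + K2%:R * d n <= e by rewrite -mulrDl.
have e2E : e2 = e + e by rewrite /e -splitr.
move: (n%:R * d n) (K1%:R * d n) (K2%:R * d n) K1d K2d h1 h2 h3.
rewrite e2E /k => u v z v0 z0 h1 h2 h3.
rewrite ler_distl; apply/andP; split; lra.
Unshelve. all: end_near. Qed.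

End rate.

Theorem theorem4p1 (R : realType)
    (mu : probability (measurableTypeR R) R) (eps : R) (eps_gt0 : 0 < eps)
    (x p : forall n : nat, 'rV[R]_n)
    (xp_best : forall n : nat, (0 < n)%N -> best_approx eps mu (x n) (p n))
    (mu_inv : {sigma_finite_measure set (measurableTypeR R) -> \bar R})
    (mu_invP : is_inverse_measure mu mu_inv)
    (mu_invA mu_invS : {measure set (measurableTypeR R) -> \bar R})
    (mu_inv_decomp :
      lebesgue_decomposition lebesgue_measure mu_inv mu_invA mu_invS)
    (f : measurableTypeR R -> R)
    (f_density : is_density lebesgue_measure mu_invA f) :
  (n%:R * levy_dist eps mu (delta (x n) (p n)))%:E @[n --> \oo] -->
    (\int[lebesgue_measure]_t (Omega (eps * f t))%:E)%E.
Proof.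
have [nuC nuI] := mu_invP.
have [nuAS _ sing] := mu_inv_decomp.
have [N [mN N0 NC N1]] := singular_carrier sing.
have nuI' (a b : R) : 0 < a -> a <= b -> b < 1 ->
    mu_inv `]a, b]%classic = (quantile mu b - quantile mu a)%:E.
  move=> a0 ab b1; rewrite nuI//.
  have [-> _] := quantile_spec mu a0 (le_lt_trans ab b1).
  by have [-> _] := quantile_spec mu (lt_le_trans a0 ab) b1.
rewrite (integral_Omega eps_gt0 nuC nuAS f_density mN N0 NC).
apply: cvg_EFin; first by apply: nearW.
exact: (best_approx_rate eps_gt0 nuI' nuAS f_density mN N0 NC N1 xp_best).
Qed.
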